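(* Let $M$ be a manifold with a time-dependent Riemannian metric $g=(g_t)_{t\in\mathbb{R}}$, and let $\gamma\colon I=[a,b]\to M$ be a smooth path. Then $\gamma$ is a critical path of the energy functional $$\mathrm{Energy}[\gamma]=\int_a^b \tfrac12\, g_t(\gamma'(t),\gamma'(t))\,\mathrm{d}t$$ if and only if $$\nabla_t\gamma' + G^{-1}\cdot\dot G\cdot\gamma' = 0 ,$$ that is, for all $t\in I$, $(\nabla_t\gamma')(t)+G_t^{-1}(\dot G_t(\gamma'(t)))=0$ in $\mathrm{T}_{\gamma(t)}M$.
   Context: All manifolds are smooth and paracompact, and all maps are smooth. A time-dependent Riemannian metric on $M$ is a smooth map $g\colon\mathbb{R}\times M\to \mathrm{T}^*M\otimes \mathrm{T}^*M$ such that each $g_t=g(t,\cdot)$ is a Riemannian metric on $M$. $G_t\colon \mathrm{T}M\to \mathrm{T}^*M$, $v\mapsto g_t(v,\cdot)$, is the musical isomorphism of $g_t$, $G_t^{-1}$ is its inverse, and $\dot G_t\colon \mathrm{T}M\to\mathrm{T}^*M$ is the time-derivative, $v\mapsto \dot g_t(v,\cdot)$, where $\dot g_t=\partial g/\partial t$ is the derivative of $g$ with respect to $t$ at a fixed point of $M$. Let $^t\nabla$ be the Levi-Civita connection of $g_t$, with Christoffel symbols $\Gamma_{ij}^k(t,x)$. For a vector field $w$ along a path $\gamma$, the covariant derivative with respect to this one-parameter family of connections is given in coordinates by $$\nabla_t w(t)=\left(\dot w^k(t)+\Gamma_{ij}^k(t,\gamma(t))\,\dot\gamma^i(t)\,w^j(t)\right)\left.\frac{\partial}{\partial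 x^k}\right|_{\gamma(t)} .$$ A path $\gamma\colon[a,b]\to M$ is critical for a functional if the first variation of the functional at $\gamma$ vanishes for all smooth variations of $\gamma$ with fixed endpoints (equivalently, if $\gamma$ satisfies the Euler–Lagrange equations of the functional). *)

(* Defs.v *)
From HB Require Import structures.
From mathcomp Require Import all_boot all_order all_algebra.
From mathcomp Require Import all_classical all_reals all_analysis.
From mathcomp Require Import ring.

Set Implicit Arguments.
Unset Strict Implicit.
Unset Printing Implicit Defensive.

Import Order.TTheory GRing.Theory Num.Theory.
Import numFieldNormedType.Exports.

Local Open Scope classical_set_scope.
Local Open Scope ring_scope.

Section Smoothness.
Context {R : realType} {V W : normedModType R}.

(* [Ck] and [Cinfty] are meant for open [U] and finite-dimensional [V], where
   they agree with the usual notions. *)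
Fixpoint Ck (k : nat) (U : set V) (f : V -> W) : Prop :=
  if k is k'.+1 then
    (forall x, U x -> differentiable f x) /\
    (forall v, Ck k' U (fun x => 'D_v f x))
  else forall x, U x -> {for x, continuous f}.

Definition Cinfty (U : set V) (f : V -> W) : Prop := forall k, Ck k U f.

(* Smoothness on an arbitrary set (closed intervals and strips are needed):
   around each point of [A], [f] coincides on [A] with a smooth function
   defined on an open neighbourhood of that point. *)
Definition smooth_on (A : set V) (f : V -> W) : Prop :=
  forall x, A x -> exists (U : set V) (h : V -> W),
    [/\ open U, U x, Cinfty U h & forall y, U y -> A y -> h y = f y].

End Smoothness.

(* Derivative relative to a set [A] of times: two-sided at interior points of
   an interval [A], one-sided at its endpoints. *)
Definition derive_within {R : realType} {W : normedModType R} (A : set R)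
    (f : R -> W) (t : R) : W :=
  lim ((fun h => h^-1 *: (f (h + t) - f t)) @
         within (fun h => A (h + t)) (0 : R)^').

Definition paracompact (T : topologicalType) : Prop :=
  forall U : set (set T),
    (forall A, U A -> open A) -> (forall x, exists2 A, U A & A x) ->
    exists V : set (set T),
      [/\ forall B, V B -> open B,
          forall x, exists2 B, V B & B x,
          forall B, V B -> exists2 A, U A & B `<=` A &
          forall x : T, exists2 N, nbhs x N &
            finite_set [set B | V B /\ B `&` N !=set0]].

(* [chart_coord] and [chart_point] are total functions; only the values of
   [chart_coord] on [chart_dom] and of [chart_point] on
   [chart_coord @` chart_dom] are meaningful. *)
Record chart (R : realType) (n : nat) (T : topologicalType) := Chart {
  chart_dom : set T ;
  chart_coord : T -> 'rV[R]_n ;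
  chart_point : 'rV[R]_n -> T ;
  chart_open : open chart_dom ;
  chart_image_open : open (chart_coord @` chart_dom) ;
  chart_coordK : forall x, chart_dom x -> chart_point (chart_coord x) = x ;
  chart_coord_continuous :
    forall x, chart_dom x -> {for x, continuous chart_coord} ;
  chart_point_continuous :
    forall y, (chart_coord @` chart_dom) y -> {for y, continuous chart_point} }.

Definition transition (R : realType) n (T : topologicalType)
  (c d : chart R n T) : 'rV[R]_n -> 'rV[R]_n := chart_coord d \o chart_point c.

Record manifold (R : realType) (n : nat) := Manifold {
  carrier :> topologicalType ;
  atlas : set (chart R n carrier) ;
  atlas_cover : forall x, exists2 c, atlas c & chart_dom c x ;
  atlas_smooth : forall c d, atlas c -> atlas d ->
    Cinfty (chart_coord c @` (chart_dom c `&` chart_dom d)) (transition c d) ;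
  manifold_hausdorff : hausdorff_space carrier ;
  manifold_paracompact : paracompact carrier }.

Arguments atlas {R n} m.

Section Manifold.
Context {R : realType} {n : nat} (M : manifold R n).

Local Notation chartM := (chart R n M).

Definition chart_at (x : M) : chartM := projT1 (cid2 (atlas_cover x)).

Definition smooth_map {V : normedModType R} (A : set V) (f : V -> M) : Prop :=
  {within A, continuous f} /\
  forall c : chartM, atlas M c ->
    smooth_on (A `&` f @^-1` chart_dom c) (chart_coord c \o f).

(* A tangent vector or a covector at [x] is given by its components in the
   charts around [x].  The components [u] of a tangent vector in [c] become
   [tangent_change c d x u] in [d]. *)
Definition tangent_change (c d : chartM) (x : M) (u : 'rV[R]_n) : 'rV[R]_n :=
  'D_u (transition c d) (chart_coord c x).

Definition bilin (A : 'M[R]_n) (u v : 'rV[R]_n) : R :=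
  \sum_(i < n) \sum_(j < n) A i j * u 0 i * v 0 j.

(* [gcomp c t x] is the matrix of the components at [x] of the metric [g_t] in
   the chart [c]; these are only constrained for [c] in the atlas and [x] in
   [chart_dom c]. *)
Record riemannian_metric := RiemannianMetric {
  gcomp : chartM -> R -> M -> 'M[R]_n ;
  gcomp_smooth : forall c, atlas M c ->
    Cinfty ([set: R] `*` (chart_coord c @` chart_dom c))
      (fun p : R * 'rV[R]_n => gcomp c p.1 (chart_point c p.2)) ;
  gcomp_change : forall c d t x,
    atlas M c -> atlas M d -> chart_dom c x -> chart_dom d x ->
    forall u v, bilin (gcomp c t x) u v =
      bilin (gcomp d t x) (tangent_change c d x u) (tangent_change c d x v) ;
  gcomp_sym : forall c t x, atlas M c -> chart_dom c x ->
    forall i j, gcomp c t x i j = gcomp c t x j i ;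
  gcomp_pos : forall c t x, atlas M c -> chart_dom c x ->
    forall u, u != 0 -> 0 < bilin (gcomp c t x) u u }.

Variable g : riemannian_metric.

Definition gdot (c : chartM) (t : R) (x : M) : 'M[R]_n :=
  derive1 (fun s => gcomp g c s x) t.

(* Components of the covectors g_t(v, .) and (dg/dt)_t(v, .), and of the
   tangent vector whose image under [flat] is a given covector. *)
Definition flat (c : chartM) (t : R) (x : M) (v : 'rV[R]_n) : 'rV[R]_n :=
  v *m gcomp g c t x.
Definition flat_dot (c : chartM) (t : R) (x : M) (v : 'rV[R]_n) : 'rV[R]_n :=
  v *m gdot c t x.
Definition sharp (c : chartM) (t : R) (x : M) (w : 'rV[R]_n) : 'rV[R]_n :=
  w *m invmx (gcomp g c t x).

(* partial derivative along the l-th coordinate of g_ij, at time t *)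
Definition dgcomp (c : chartM) (t : R) (x : M) (l i j : 'I_n) : R :=
  'D_(delta_mx 0 l) (fun y => gcomp g c t (chart_point c y) i j)
    (chart_coord c x).

(* [christoffel c t x k i j] is Gamma^k_ij; see [christoffelP]. *)
Definition christoffel (c : chartM) (t : R) (x : M) (k i j : 'I_n) : R :=
  2^-1 * \sum_(l < n) invmx (gcomp g c t x) k l *
    (dgcomp c t x i j l + dgcomp c t x j i l - dgcomp c t x l i j).

Section Path.
Variables a b : R.

(* Paths are functions on R of which only the restriction to [a, b] is used. *)
Definition velocity (p : R -> M) (c : chartM) (t : R) : 'rV[R]_n :=
  derive_within `[a, b] (chart_coord c \o p) t.

(* [w c t] are the components in [c] of the value at time [t] of a vector
   field along [p], meaningful when [p t] is in [chart_dom c]. *)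
Definition covariant_derivative (p : R -> M) (w : chartM -> R -> 'rV[R]_n)
    (c : chartM) (t : R) : 'rV[R]_n :=
  \row_(k < n) (derive_within `[a, b] (w c) t 0 k +
    \sum_(i < n) \sum_(j < n)
      christoffel c t (p t) k i j * velocity p c t 0 i * w c t 0 j).

(* By [gcomp_change] the integrand does not depend on the chart around
   [p t] that is used to compute it. *)
Definition energy (p : R -> M) : R :=
  \int[lebesgue_measure]_(t in `[a, b])
    (2^-1 * bilin (gcomp g (chart_at (p t)) t (p t))
                  (velocity p (chart_at (p t)) t)
                  (velocity p (chart_at (p t)) t)).

(* The parameter of a variation [H] is the first component of its argument,
   and the time is the second one. *)
Definition variation (p : R -> M) (e : R) (H : R * R -> M) : Prop :=
  [/\ smooth_map (`]- e, e[ `*` `[a, b]) H,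
      forall t, t \in `[a, b] -> H (0, t) = p t,
      forall s, s \in `]- e, e[ -> H (s, a) = p a &
      forall s, s \in `]- e, e[ -> H (s, b) = p b].

Definition critical (p : R -> M) : Prop :=
  forall (e : R) (H : R * R -> M), 0 < e -> variation p e H ->
    is_derive (0 : R) (1 : R) (fun s => energy (fun t => H (s, t))) 0.

End Path.

Lemma gcomp_unit c t x : atlas M c -> chart_dom c x -> gcomp g c t x \in unitmx.
Proof.
move=> ac cx; rewrite -row_free_unit -kermx_eq0.
apply/eqP/row_matrixP => i; rewrite row0; apply/eqP/negPn/negP => /gcomp_pos.
move=> /(_ g c t x ac cx); suff -> : bilin (gcomp g c t x)
  (row i (kermx (gcomp g c t x))) (row i (kermx (gcomp g c t x))) = 0.
  by rewrite ltxx.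
have kg : row i (kermx (gcomp g c t x)) *m gcomp g c t x = 0.
  by rewrite -row_mul mulmx_ker row0.
rewrite /bilin exchange_big /= big1 // => j _; rewrite -mulr_suml.
have /rowP/(_ j) := kg; rewrite !mxE => E.
rewrite (eq_bigr (fun i0 => row i (kermx (gcomp g c t x)) 0 i0 *
  gcomp g c t x i0 j)); first by rewrite E mul0r.
by move=> l _; rewrite mulrC.
Qed.

Lemma flatK c t x : atlas M c -> chart_dom c x ->
  cancel (flat c t x) (sharp c t x).
Proof. by move=> ac cx v; rewrite /sharp /flat mulmxK // gcomp_unit. Qed.

Lemma sharpK c t x : atlas M c -> chart_dom c x ->
  cancel (sharp c t x) (flat c t x).
Proof. by move=> ac cx w; rewrite /sharp /flat mulmxKV // gcomp_unit. Qed.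

Lemma dgcomp_sym c t x l i j : atlas M c -> chart_dom c x ->
  dgcomp c t x l i j = dgcomp c t x l j i.
Proof.
move=> ac cx; rewrite /dgcomp; apply: near_eq_derive.
have : nbhs (chart_coord c x) (chart_coord c @` chart_dom c).
  by apply: open_nbhs_nbhs; split; [exact: chart_image_open|exists x].
apply: filterS => _ [y cy <-]; rewrite chart_coordK //; exact: gcomp_sym.
Qed.

(* The Christoffel symbols are the coefficients of the Levi-Civita connection,
   the only connection which is torsion-free and compatible with g_t. *)
Lemma christoffelP c t x (G : 'I_n -> 'I_n -> 'I_n -> R) :
  atlas M c -> chart_dom c x ->
  (forall k i j, G k i j = christoffel c t x k i j) <->
  (forall k i j, G k i j = G k j i) /\
  (forall l i j, dgcomp c t x l i j =
     \sum_(m < n) (G m l i * gcomp g c t x m j + G m l j * gcomp g c t x i m)).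
Proof.
move=> ac cx; set A := gcomp g c t x.
have Au : A \in unitmx by exact: gcomp_unit.
have As i j : A i j = A j i by exact: gcomp_sym.
have Ds l i j : dgcomp c t x l i j = dgcomp c t x l j i by exact: dgcomp_sym.
have mulVA k m : \sum_(l < n) invmx A k l * A l m = (k == m)%:R.
  by have /matrixP/(_ k m) := mulVmx Au; rewrite !mxE.
have mulAV k m : \sum_(l < n) A k l * invmx A l m = (k == m)%:R.
  by have /matrixP/(_ k m) := mulmxV Au; rewrite !mxE.
have sum_delta (F : 'I_n -> R) m : \sum_(l < n) (m == l)%:R * F l = F m.
  rewrite (bigD1 m) //= eqxx mul1r big1 ?addr0 // => l.
  by rewrite eq_sym => /negPf ->; rewrite mul0r.
split=> [Gc|[Gs Gd] k i j].
  have lower i j m : \sum_(k < n) G k i j * A k m = 2^-1 *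
      (dgcomp c t x i j m + dgcomp c t x j i m - dgcomp c t x m i j).
    under eq_bigr do rewrite Gc /christoffel -mulrA mulr_suml.
    rewrite -mulr_sumr exchange_big /=; congr (_ * _).
    rewrite -[RHS](sum_delta (fun m => dgcomp c t x i j m +
      dgcomp c t x j i m - dgcomp c t x m i j)).
    apply: eq_bigr => l _; rewrite -mulAV mulr_suml; apply: eq_bigr => k _.
    by rewrite (As k m) mulrC mulrA.
  split=> [k i j|l i j].
    rewrite !Gc /christoffel; congr (_ * _); apply: eq_bigr => l _.
    by rewrite (Ds l i j) [dgcomp _ _ _ i _ _ + _]addrC.
  rewrite big_split /= lower.
  under eq_bigr do rewrite -/A As.
  rewrite lower (Ds l j i) -mulrDr.
  by set u := dgcomp _ _ _ _ _ _; set v := dgcomp _ _ _ _ _ _;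
    set w := dgcomp _ _ _ _ _ _; field.
pose L i j m := \sum_(k < n) G k i j * A k m.
have DL l i' j' : dgcomp c t x l i' j' = L l i' j' + L l j' i'.
  rewrite Gd big_split /=; congr (_ + _); apply: eq_bigr => m _.
  by rewrite -/A As.
have Ls i' j' m : L i' j' m = L j' i' m.
  by apply: eq_bigr => k' _; rewrite Gs.
rewrite /christoffel -/A.
under eq_bigr => l _.
  rewrite !DL (Ls j i l) (Ls l j i) (Ls l i j).
  rewrite (_ : _ - _ = 2 * L i j l); last by ring.
  rewrite mulrCA.
  over.
rewrite -mulr_sumr mulrA mulVf ?mul1r ?pnatr_eq0 //.
under eq_bigr do rewrite mulr_sumr.
rewrite exchange_big /= -[LHS](sum_delta (fun k => G k i j)).
apply: eq_bigr => k' _; rewrite -mulVA mulr_suml; apply: eq_bigr => l _.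
by rewrite (As k' l) mulrCA mulrC.
Qed.

End Manifold.

(* Main.v *)
(* In a chart, the derivative of the Lagrangian in the variation parameter s is
   the t-derivative of the momentum pairing g(gamma', V), V being the variation
   field, minus the Euler-Lagrange covector applied to V; the mixed derivatives
   cancel by symmetry. Lagrangian and pairing do not depend on the chart, so
   their difference is a global density on [a, b], and integrating gives
   d/ds Energy = - \int g(nabla_t gamma' + G^-1 Gdot gamma', V) dt, the pairing
   vanishing at the endpoints. Conversely, if the vector field
   nabla_t gamma' + G^-1 Gdot gamma' has a nonzero value w at some time, let V
   be a bump function times w in a chart, supported near that time inside
   ]a, b[: then the density is nonnegative, continuous and not identically 0. *)

Require Import Defs.
From HB Require Import structures.
From mathcomp Require Import all_boot all_order all_algebra.
From mathcomp Require Import all_classical all_reals all_analysis.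
From mathcomp Require Import ring lra.

Set Implicit Arguments.
Unset Strict Implicit.
Unset Printing Implicit Defensive.

Import Order.TTheory GRing.Theory Num.Theory.
Import numFieldNormedType.Exports.

Local Open Scope classical_set_scope.
Local Open Scope ring_scope.

(** * Iterated derivatives *)

Section CkCalculus.
Context {R : realType}.
Implicit Types V W : normedModType R.

(** Smoothness on a strip with closed time interval only means that local smooth extensions exist,
    and velocities are one-sided at the endpoints. So each computation is made for an extension [h]
    of the coordinates to an open set of pairs (s, t), where ordinary calculus applies, and is
    brought back to the strip, where [h] agrees with the variation. The Christoffel symbols are not
    expanded through the inverse matrix: pairing with a vector lowers the index, and
    torsion-freeness and metric compatibility alone identify the result with the Euler-Lagrange
    expression. In the converse the time where the vector field is nonzero may be an endpoint, where
    no bump fits. Continuity of the pairing with the fixed components [w] first moves the time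
    inside. The perturbed path is written in the chart on a tube twice as wide as the bump, so that
    it agrees with the old path near the rim of the tube. *)

Lemma CkSP {V W} k (U : set V) (f : V -> W) : Ck k.+1 U f <->
  (forall x, U x -> differentiable f x) /\ (forall v, Ck k U (fun x => 'D_v f x)).
Proof. by []. Qed.

Lemma Ck_sub {V W} k (U U' : set V) (f : V -> W) :
  U' `<=` U -> Ck k U f -> Ck k U' f.
Proof.
move=> sU; elim: k f => [|k IH] f /=; first by move=> cf x /sU /cf.
by move=> /CkSP[df dDf]; split=> [x /sU /df|v] //; exact: IH.
Qed.

Lemma near_open_eq {V W} (U : set V) (f g : V -> W) x : open U -> U x ->
  (forall y, U y -> f y = g y) -> \near x, f x = g x.
Proof.
move=> oU Ux fg; have : nbhs x U by exact: open_nbhs_nbhs.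
by apply: filterS.
Qed.

(** The remainder in a first-order expansion only depends on the germ, so the expansion of [f]
    serves for [g]; uniqueness of differentials does the rest. *)
Lemma near_eq_differentiable {V W} (f g : V -> W) x :
  (\near x, f x = g x) -> differentiable f x -> differentiable g x.
Proof.
move=> fg df.
have E : g \o shift x = cst (g x) + 'd f x +o_ 0 id.
  apply/eqaddoP => _/posnumP[e].
  have /diff_locally/eqaddoP/(_ e%:num (gt0 _)) := df.
  have fg0 : \forall h \near 0, f (h + x) = g (h + x).
    by move: fg; rewrite (near_shift 0 x) /=; apply: filterS => h /=; rewrite subr0.
  apply: filterS2 fg0 => h /= fgh.
  by rewrite !fctE /= -fgh (nbhs_singleton fg).
apply/diff_locallyP; rewrite (diff_unique (diff_continuous df) E).
by split=> //; exact: diff_continuous df.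
Qed.

(** Openness of [U] turns equality on [U] into equality near each point, which is inherited by every
    directional derivative. *)
Lemma Ck_eq {V W} k (U : set V) (f g : V -> W) :
  open U -> (forall x, U x -> f x = g x) -> Ck k U f -> Ck k U g.
Proof.
move=> oU; elim: k f g => [|k IH] f g fg /=.
  move=> cf x Ux; have := cf x Ux; rewrite /prop_for /continuous_at -fg //.
  by apply: cvg_trans; apply: near_eq_cvg; exact: near_open_eq fg.
move=> /CkSP[df dDf]; split=> [x Ux|v].
  apply: near_eq_differentiable (df x Ux); exact: near_open_eq fg.
apply: IH (dDf v) => x Ux.
by apply: near_eq_derive; exact: near_open_eq fg.
Qed.

Lemma CkS {V W} k (U : set V) (f : V -> W) : Ck k.+1 U f -> Ck k U f.
Proof.
elim: k f => [|k IH] f [df dDf].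
  by move=> x Ux; exact/differentiable_continuous/df.
by split=> // v; exact: IH.
Qed.

Lemma Ck_cst {V W} k (U : set V) (w : W) : Ck k U (cst w : V -> W).
Proof.
elim: k w => [|k IH] w /=; first by move=> x _; exact: cst_continuous.
split=> [x _|v]; first exact: differentiable_cst.
suff -> : (fun x => 'D_v (cst w) x) = cst 0 :> (V -> W) by exact: IH.
by apply/funext => x; exact: derive_cst.
Qed.

Lemma CkD {V W} k (U : set V) (f g : V -> W) : open U ->
  Ck k U f -> Ck k U g -> Ck k U (fun x => f x + g x).
Proof.
move=> oU; elim: k f g => [|k IH] f g.
  by move=> cf cg x Ux; apply: cvgD; [exact: cf|exact: cg].
move=> /CkSP[df dDf] /CkSP[dg dDg]; split=> [x Ux|v].
  by apply: differentiableD; [exact: df|exact: dg].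
apply: (@Ck_eq _ _ _ _ (fun x => 'D_v f x + 'D_v g x)) => //; last first.
  by apply: IH; [exact: dDf|exact: dDg].
move=> x Ux; rewrite -deriveD //; apply: diff_derivable; [exact: df|exact: dg].
Qed.

Lemma Ck_sum {V W} k (U : set V) (I : Type) (r : seq I) (P : pred I)
    (F : I -> V -> W) :
  open U -> (forall i, P i -> Ck k U (F i)) ->
  Ck k U (fun x => \sum_(i <- r | P i) F i x).
Proof.
move=> oU HF; elim: r => [|i r IH].
  by apply: (@Ck_eq _ _ _ _ (cst 0)) => // [x _|]; [rewrite big_nil|exact: Ck_cst].
apply: (@Ck_eq _ _ _ _ (fun x => (if P i then F i x else 0) +
    \sum_(i <- r | P i) F i x)) => // [x _|].
  by rewrite big_cons; case: ifP => // _; rewrite add0r.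
apply: CkD => //; by case: (P i) (HF i) => [/(_ isT)|_] //; exact: Ck_cst.
Qed.

(** Registering scaling as a bilinear map gives the Leibniz rule below as the differential of a
    bilinear map. *)
Lemma scale_is_bilinear W : bilinear_for
  (GRing.Scale.Law.clone _ _ *:%R _) (GRing.Scale.Law.clone _ _ *:%R _)
  (@GRing.scale R W : R -> W -> W).
Proof.
split=> [u|u] a x y /=; first by rewrite scalerDl scalerA.
by rewrite scalerDr !scalerA mulrC.
Qed.

HB.instance Definition _ W := bilinear_isBilinear.Build R R W W _ _
  (@GRing.scale R W) (scale_is_bilinear W).

Lemma is_diffZ_fun {V W : normedModType R} (c : V -> R) (f : V -> W) x :
  differentiable c x -> differentiable f x ->
  is_diff x (fun x => c x *: f x) (fun v => c x *: 'd f x v + 'd c x v *: f x).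
Proof.
move=> dc df; have C : continuous (fun p : R * W => p.1 *: p.2).
  by move=> p; exact: scale_continuous.
have dcf := differentiable_pair dc df.
have db : differentiable (fun p : R * W => p.1 *: p.2) (c x, f x).
  exact: (@differentiable_bilin _ _ _ _ (@GRing.scale R W)).
split; first exact: (differentiable_comp dcf db).
have := diff_comp dcf db; rewrite diff_pair //.
by rewrite (@diff_bilin _ _ _ _ (@GRing.scale R W)).
Qed.

Lemma CkZ {V W} k (U : set V) (c : V -> R) (f : V -> W) : open U ->
  Ck k U c -> Ck k U f -> Ck k U (fun x => c x *: f x).
Proof.
move=> oU; elim: k c f => [|k IH] c f.
  by move=> cf cg x Ux; apply: cvgZ; [exact: cf|exact: cg].
move=> Cc Cf; have /CkSP[dc dDc] := Cc; have /CkSP[df dDf] := Cf; split=> [x Ux|v].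
  by have [] := is_diffZ_fun (dc x Ux) (df x Ux).
apply: (@Ck_eq _ _ _ _ (fun x => c x *: 'D_v f x + 'D_v c x *: f x)) => //.
  move=> x Ux; have [D E] := is_diffZ_fun (dc x Ux) (df x Ux).
  by rewrite [RHS]deriveE // E (deriveE _ (df x Ux)) (deriveE _ (dc x Ux)).
by apply: CkD => //; apply: IH => //; exact: CkS.
Qed.

(** Continuous linearity expressed through differentials, so that plain functions such as
    coordinates and projections qualify without a bundled linear structure. *)
Definition clinear {V W} (L : V -> W) : Prop :=
  forall x, differentiable L x /\ forall y, 'd L x y = L y.

Lemma clinear_derive {V V' W} (L : V' -> W) (f : V -> V') x v :
  clinear L -> differentiable f x -> 'D_v (L \o f) x = L ('D_v f x).
Proof.
move=> cL df; have [dL eL] := cL (f x).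
rewrite !deriveE //; last exact: differentiable_comp.
by rewrite diff_comp //= eL.
Qed.

Lemma Ck_clinear {V V' W} k (U : set V) (L : V' -> W) (f : V -> V') :
  open U -> clinear L -> Ck k U f -> Ck k U (L \o f).
Proof.
move=> oU cL; elim: k f => [|k IH] f.
  move=> cf x Ux; apply: continuous_comp; first exact: cf.
  by apply: differentiable_continuous; have [] := cL (f x).
move=> /CkSP[df dDf]; split=> [x Ux|v].
  by apply: differentiable_comp; [exact: df|have [] := cL (f x)].
apply: (@Ck_eq _ _ _ _ (L \o (fun x => 'D_v f x))) => //; last exact: IH.
by move=> x Ux; rewrite clinear_derive //; exact: df.
Qed.

Lemma clinear_linear {V W} (L : {linear V -> W}) : continuous L -> clinear L.
Proof.
move=> cL x; split; first exact: linear_differentiable.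
by move=> y; rewrite diff_lin.
Qed.

Lemma clinear_id V : clinear (@id V).
Proof. by apply: (@clinear_linear _ _ idfun) => x. Qed.

Lemma clinear_fst V W : clinear (@fst V W).
Proof. apply: (@clinear_linear _ _ fst) => x. exact: cvg_fst. Qed.

Lemma clinear_snd V W : clinear (@snd V W).
Proof. apply: (@clinear_linear _ _ snd) => x. exact: cvg_snd. Qed.

Lemma clinear_comp {V V' W} (K : V -> V') (L : V' -> W) :
  clinear K -> clinear L -> clinear (L \o K).
Proof.
move=> cK cL x; have [dK eK] := cK x; have [dL eL] := cL (K x).
split=> [|y]; first exact: differentiable_comp.
by rewrite diff_comp //= eL eK.
Qed.

Lemma clinear_coord m n (i : 'I_m) (j : 'I_n) :
  clinear (fun A : 'M[R]_(m, n) => A i j).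
Proof.
move=> A; split; first exact: differentiable_coord.
move=> B; rewrite -deriveE; last exact: differentiable_coord.
(* The differential is read off entrywise from the derivative of the identity matrix function. *)
have D : derivable (@id 'M[R]_(m, n)) A B by exact: derivable_id.
by have := derive_mx D; rewrite derive_id => /matrixP/(_ i j); rewrite mxE.
Qed.

Lemma Ck_pair {V W W' : normedModType R} k (U : set V) (f : V -> W)
    (g : V -> W') : open U ->
  Ck k U f -> Ck k U g -> Ck k U (fun x => (f x, g x)).
Proof.
move=> oU; elim: k f g => [|k IH] f g.
  by move=> cf cg x Ux; apply: cvg_pair; [exact: cf|exact: cg].
move=> /CkSP[df dDf] /CkSP[dg dDg]; split=> [x Ux|v].
  by apply: differentiable_pair; [exact: df|exact: dg].
apply: (@Ck_eq _ _ _ _ (fun x => ('D_v f x, 'D_v g x))) => //; last exact: IH.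
move=> x Ux; have [dfx dgx] := (df x Ux, dg x Ux).
by rewrite !deriveE ?diff_pair //; exact: differentiable_pair.
Qed.

(* [Ck] only differentiates in constant directions, so the chain rule at higher
   order needs finitely many directions that span the intermediate space. *)
Definition has_frame V : Prop :=
  exists (I : finType) (e : I -> V) (xi : I -> V -> R),
    (forall i, clinear (xi i)) /\ forall v, v = \sum_i xi i v *: e i.

Lemma has_frame_real : has_frame R.
Proof.
exists unit, (fun=> 1), (fun=> id); split=> [_|v]; first exact: clinear_id.
by rewrite big_const card_unit /= addr0 [_ *: _]mulr1.
Qed.

Lemma has_frame_rV n : has_frame 'rV[R]_n.
Proof.
exists 'I_n, (delta_mx 0), (fun i (v : 'rV[R]_n) => v 0 i); split=> [i|v].
  exact: clinear_coord.
exact: row_sum_delta.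
Qed.

Lemma has_frame_prod {V W} : has_frame V -> has_frame W ->
  has_frame (V * W)%type.
Proof.
move=> [I [e [xi [cxi He]]]] [J [f [eta [ceta Hf]]]].
exists (I + J)%type,
  (fun k => match k with inl i => (e i, 0) | inr j => (0, f j) end),
  (fun k v => match k with inl i => xi i v.1 | inr j => eta j v.2 end).
split=> [[i|j]|[v w]].
- exact: (clinear_comp (@clinear_fst _ _) (cxi i)).
- exact: (clinear_comp (@clinear_snd _ _) (ceta j)).
rewrite big_sumType /= [v in LHS]He [w in LHS]Hf.
have -> : \sum_i xi i v *: (e i, 0 : W) = (\sum_i xi i v *: e i, 0).
  elim/big_ind2 : _ => // [x x' y y' -> ->|i _]; first by congr pair; rewrite addr0.
  by congr pair; rewrite scaler0.
have -> : \sum_j eta j w *: (0 : V, f j) = (0, \sum_j eta j w *: f j).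
  elim/big_ind2 : _ => // [x x' y y' -> ->|j _]; first by congr pair; rewrite addr0.
  by congr pair; rewrite scaler0.
by congr pair; rewrite ?addr0 ?add0r.
Qed.

Lemma Ck_comp {V V' W} k (U : set V) (U' : set V') (f : V -> V') (g : V' -> W) :
  has_frame V' -> open U -> (forall x, U x -> U' (f x)) ->
  Ck k U f -> Ck k U' g -> Ck k U (g \o f).
Proof.
move=> [I [e [xi [cxi He]]]] oU fU.
elim: k f g fU => [|k IH] f g fU.
  by move=> cf cg x Ux; apply: continuous_comp; [exact: cf|exact/cg/fU].
move=> Cf /CkSP[dg dDg]; have /CkSP[df dDf] := Cf; split=> [x Ux|v].
  by apply: differentiable_comp; [exact: df|exact/dg/fU].
(* Expanding ['D_v f x] in the frame leaves only derivatives of [g] in the constant directions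
   [e i], to which the induction hypothesis applies. *)
apply: (@Ck_eq _ _ _ _ (fun x =>
  \sum_i xi i ('D_v f x) *: ('D_(e i) g \o f) x)) => //.
  move=> x Ux; have [dfx dgx] := (df x Ux, dg _ (fU x Ux)).
  rewrite (deriveE _ dfx) [RHS]deriveE; last exact: differentiable_comp.
  rewrite (diff_comp dfx dgx) /= [in RHS](He ('d f x v)) linear_sum.
  by apply: eq_bigr => i _; rewrite linearZ /= deriveE.
apply: Ck_sum => // i _; apply: CkZ => //.
  exact: (@Ck_clinear _ _ _ _ _ (xi i)).
by apply: IH => //; exact: CkS.
Qed.

Lemma Cinfty_derive {V W} (U : set V) (f : V -> W) v :
  Cinfty U f -> Cinfty U (fun x => 'D_v f x).
Proof. by move=> cf k; have /CkSP[_] := cf k.+1; exact. Qed.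

Lemma Cinfty_differentiable {V W} (U : set V) (f : V -> W) x :
  Cinfty U f -> U x -> differentiable f x.
Proof. by move=> /(_ 1%N)[+ _]; exact. Qed.

Lemma Cinfty_continuous {V W} (U : set V) (f : V -> W) x :
  Cinfty U f -> U x -> {for x, continuous f}.
Proof. by move=> /(_ 0%N) /=; exact. Qed.

End CkCalculus.

(** * Derivatives along lines and symmetry of mixed derivatives *)

Section Lines.
Context {R : realType}.
Implicit Types V W : normedModType R.

(** When [c] is affine along [u], both difference quotients are the same function, so their limits
    coincide by definition. The next two lemmas use the same observation. *)
Lemma derive_affine {V V' W} (f : V -> W) (c : V' -> V) u v x :
  (forall h, c (h *: u + x) = h *: v + c x) ->
  'D_u (f \o c) x = 'D_v f (c x).
Proof.
move=> cE; rewrite /derive.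
suff -> : (fun h : R => h^-1 *: (((f \o c) \o shift x) (h *: u) - (f \o c) x)) =
  (fun h => h^-1 *: ((f \o shift (c x)) (h *: v) - f (c x))) by [].
by apply/funext => h /=; rewrite cE.
Qed.

Lemma derive_line {V W} (f : V -> W) (c : R -> V) v x :
  (forall h, c (h + x) = h *: v + c x) ->
  (derivable f (c x) v -> derivable (f \o c) x 1) /\
  'D_1 (f \o c) x = 'D_v f (c x).
Proof.
move=> cE; rewrite /derivable /derive.
suff -> : (fun h : R => h^-1 *: (((f \o c) \o shift x) (h *: 1) - (f \o c) x)) =
  (fun h => h^-1 *: ((f \o shift (c x)) (h *: v) - f (c x))) by [].
by apply/funext => h /=; rewrite [_ *: 1]mulr1 cE.
Qed.

Lemma is_derive_line {V W} (f : V -> W) (c : R -> V) v x df :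
  (forall h, c (h + x) = h *: v + c x) -> is_derive (c x) v f df ->
  is_derive x 1 (f \o c) df.
Proof.
move=> cE [df1 df2]; have [D E] := derive_line f cE.
by split; [exact: D|exact: etrans E df2].
Qed.

Section MixedDerivatives.
Context {V : normedModType R}.
Implicit Types (U : set V) (p v w : V).

(** The mean value theorem is applied twice: along [v] to the difference of [f] at points shifted by
    [t *: w], then along [w] to the derivative [fv] so obtained. *)
Lemma second_difference U p v w (f fv fvw : V -> R) (t : R) : 0 <= t ->
  (forall x, U x -> is_derive x v f (fv x)) ->
  (forall x, U x -> is_derive x w fv (fvw x)) ->
  (forall x y : R, x \in `[0, t] -> y \in `[0, t] -> U (x *: v + (y *: w + p))) ->
  exists x y : R, [/\ x \in `[0, t], y \in `[0, t] &
    f (t *: v + (t *: w + p)) - f (t *: v + p) - (f (t *: w + p) - f p)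
      = fvw (x *: v + (y *: w + p)) * (t * t)].
Proof.
move=> t0 df dfv HU.
have t_in : t \in `[0, t] by rewrite in_itv /= t0 lexx.
have O_in : 0 \in `[0, t] by rewrite in_itv /= t0 lexx.
have lv q x h : (h + x) *: v + q = h *: v + (x *: v + q).
  by rewrite scalerDl addrA.
have lw (x y h : R) : x *: v + ((h + y) *: w + p) = h *: w + (x *: v + (y *: w + p)).
  by rewrite scalerDl -addrA [LHS]addrCA.
have HU' (x : R) : x \in `[0, t] -> U (x *: v + p).
  by move=> xt; have := HU x 0 xt O_in; rewrite scale0r add0r.
have D1 (x : R) : x \in `[0, t] -> is_derive x 1
    (fun x => f (x *: v + (t *: w + p)) - f (x *: v + p))
    (fv (x *: v + (t *: w + p)) - fv (x *: v + p)).
  move=> xt; apply: is_deriveB.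
    exact: (@is_derive_line _ _ f (fun x => x *: v + (t *: w + p)) v x _
      (lv _ x) (df _ (HU x t xt t_in))).
  exact: (@is_derive_line _ _ f (fun x => x *: v + p) v x _
    (lv _ x) (df _ (HU' x xt))).
have itvW (x : R) : x \in `]0, t[ -> x \in `[0, t].
  by rewrite !in_itv /= => /andP[? ?]; rewrite !ltW.
have [x xt] := MVT_segment t0 (fun x xt => D1 x (itvW x xt))
  (derivable_within_continuous (fun x xt => @ex_derive _ _ _ _ _ _ _ (D1 x xt))).
rewrite subr0 !scale0r !add0r => ->.
have D2 (y : R) : y \in `[0, t] -> is_derive y 1
    (fun y => fv (x *: v + (y *: w + p))) (fvw (x *: v + (y *: w + p))).
  move=> yt; exact: (@is_derive_line _ _ fv
    (fun y => x *: v + (y *: w + p)) w y _ (lw x y) (dfv _ (HU x y xt yt))).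
have [y yt] := MVT_segment t0 (fun y yt => D2 y (itvW y yt))
  (derivable_within_continuous (fun y yt => @ex_derive _ _ _ _ _ _ _ (D2 y yt))).
rewrite subr0 !scale0r !add0r => ->.
by exists x, y; split => //; rewrite mulrA.
Qed.

(* Both mixed derivatives are the limit of the same second difference
   quotient. *)
Lemma mixed_derivatives_eq U p v w (f fv fw fvw fwv : V -> R) :
  open U -> U p ->
  (forall x, U x -> is_derive x v f (fv x)) ->
  (forall x, U x -> is_derive x w f (fw x)) ->
  (forall x, U x -> is_derive x w fv (fvw x)) ->
  (forall x, U x -> is_derive x v fw (fwv x)) ->
  {for p, continuous fvw} -> {for p, continuous fwv} -> fvw p = fwv p.
Proof.
move=> oU Up df_v df_w df_vw df_wv cvw cwv.
apply/eqP; rewrite -subr_eq0 -normr_le0; apply/ler_addgt0Pl => e /= e0.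
rewrite addr0; have e2 : 0 < e / 2 by rewrite divr_gt0.
(* A parallelogram with corner [p] so small that it stays in [U] and both mixed derivatives vary by
   less than [e / 2] on it. *)
have [t t0 Ht] : exists2 t : R, 0 < t & forall x y : R,
    x \in `[0, t] -> y \in `[0, t] -> let q := x *: v + (y *: w + p) in
    [/\ U q, `|fvw p - fvw q| < e / 2 & `|fwv p - fwv q| < e / 2].
  have : nbhs p [set q | [/\ U q, `|fvw p - fvw q| < e / 2 &
      `|fwv p - fwv q| < e / 2]].
    have nU : nbhs p U by exact: open_nbhs_nbhs.
    have nA : nbhs p [set q | `|fvw p - fvw q| < e / 2].
      exact: ((cvgrPdist_lt _ _).1 cvw _ e2).
    have nB : nbhs p [set q | `|fwv p - fwv q| < e / 2].
      exact: ((cvgrPdist_lt _ _).1 cwv _ e2).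
    by apply: filterS (filterI nU (filterI nA nB)) => q [Uq [Aq Bq]]; exact: And3.
  have c : (fun z : R * R => z.1 *: v + (z.2 *: w + p)) z @[z --> (0, 0)] --> p.
    rewrite -[X in _ --> X](_ : (0 : R) *: v + ((0 : R) *: w + p) = p); last first.
      by rewrite !scale0r !add0r.
    apply: cvgD; first by apply: cvgZr_tmp; exact: cvg_fst.
    by apply: cvgD; [apply: cvgZr_tmp; exact: cvg_snd|exact: cvg_cst].
  move=> /c /nbhs_ballP[r /= r0 Hr].
  exists (r / 2) => [|x y]; first by rewrite divr_gt0.
  have small z : z \in `[0, r / 2] -> ball 0 r z.
    rewrite in_itv /= => /andP[z0 zr]; rewrite /ball /= sub0r normrN ger0_norm //.
    by apply: le_lt_trans zr _; rewrite ltr_pdivrMr // ltr_pMr // ltr1n.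
  by move=> /small xr /small yr; exact: (Hr (x, y)).
have [x1 [y1 [x1t y1t E1]]] := second_difference (ltW t0) df_v df_vw
  (fun x y xt yt => let: And3 u _ _ := Ht x y xt yt in u).
(* The same second difference with the roles of [v] and [w] exchanged. *)
have [x2 [y2 [x2t y2t E2]]] : exists x y : R, [/\ x \in `[0, t], y \in `[0, t] &
    f (t *: v + (t *: w + p)) - f (t *: w + p) - (f (t *: v + p) - f p)
      = fwv (y *: v + (x *: w + p)) * (t * t)].
  have HU (x y : R) : x \in `[0, t] -> y \in `[0, t] ->
      U (x *: w + (y *: v + p)).
    by move=> xt yt; rewrite addrCA; have [] := Ht y x yt xt.
  have [x [y [xt yt E]]] := second_difference (ltW t0) df_w df_wv HU.
  by exists x, y; split => //; rewrite addrCA E addrCA.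
(* Both values times [t * t] equal one second difference, which is symmetric in [v] and [w]. *)
have AB : fvw (x1 *: v + (y1 *: w + p)) = fwv (y2 *: v + (x2 *: w + p)).
  have tt : t * t != 0 by rewrite mulf_neq0 // gt_eqF.
  by apply: (mulIf tt); rewrite -E1 -E2; ring.
have [_ A1 _] := Ht _ _ x1t y1t; have [_ _ B1] := Ht _ _ y2t x2t.
apply/ltW.
have -> : fvw p - fwv p = (fvw p - fvw (x1 *: v + (y1 *: w + p))) -
    (fwv p - fwv (y2 *: v + (x2 *: w + p))) by rewrite AB; ring.
by rewrite (splitr e) (le_lt_trans (ler_normB _ _)) // ltrD.
Qed.

End MixedDerivatives.

Lemma derive_comm {V} (U : set V) (f : V -> R) p v w : open U -> U p ->
  Ck 2 U f -> 'D_w (fun x => 'D_v f x) p = 'D_v (fun x => 'D_w f x) p.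
Proof.
move=> oU Up /CkSP[df dDf].
have df1 u x : U x -> is_derive x u f ('D_u f x).
  by move=> Ux; apply: derivableP; exact/diff_derivable/df.
have df2 u u' x : U x -> is_derive x u (fun x => 'D_u' f x)
    ('D_u (fun x => 'D_u' f x) x).
  move=> Ux; apply: derivableP; apply: diff_derivable.
  by have /CkSP[+ _] := dDf u'; exact.
have cdf u u' : {for p, continuous (fun x => 'D_u (fun x => 'D_u' f x) x)}.
  by have /CkSP[_ /(_ u)] := dDf u'; exact.
exact: (mixed_derivatives_eq oU Up (df1 v) (df1 w) (df2 w v) (df2 v w)
  (cdf w v) (cdf v w)).
Qed.

Lemma derive_comm_rV {V} n (U : set V) (f : V -> 'rV[R]_n) p v w :
  open U -> U p -> Ck 2 U f ->
  'D_w (fun x => 'D_v f x) p = 'D_v (fun x => 'D_w f x) p.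
Proof.
move=> oU Up Cf; apply/rowP => i.
pose L := fun A : 'rV[R]_n => A 0 i.
have cL : clinear L by exact: clinear_coord.
have /CkSP[df dDf] := Cf.
have E u u' : ('D_u (fun x => 'D_u' f x) p) 0 i =
    'D_u (fun x => 'D_u' (L \o f) x) p.
  rewrite -[LHS]/(L _) -(clinear_derive _ cL); last first.
    by have /CkSP[+ _] := dDf u'; exact.
  apply: near_eq_derive; apply: (near_open_eq oU Up) => y Uy.
  by rewrite (clinear_derive _ cL) //; exact: df.
have E1 := E w v.
have E2 := E v w.
apply: etrans E1 _.
apply: etrans _ (esym E2).
exact: (derive_comm v w oU Up (Ck_clinear oU cL Cf)).
Qed.

End Lines.

(** * The first variation in a chart *)

Section LocalVariation.
Context {R : realType} {n : nat}.

Lemma is_derive_sumf {V : normedModType R} m (F : 'I_m -> V -> R) dF x v :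
  (forall i, is_derive x v (F i) (dF i)) ->
  is_derive x v (fun x => \sum_i F i x) (\sum_i dF i).
Proof.
move=> HF; rewrite (_ : (fun x => _) = \sum_i F i); last first.
  by apply/funext => y; rewrite fct_sumE.
exact: is_derive_sum.
Qed.

Lemma is_derive_mulf {V : normedModType R} (f g : V -> R) df dg x v :
  is_derive x v f df -> is_derive x v g dg ->
  is_derive x v (fun x => f x * g x) (f x * dg + df * g x).
Proof.
move=> Hf Hg; rewrite [df * _]mulrC; exact: is_deriveM.
Qed.

Lemma is_derive_bilin {V : normedModType R} (A : V -> 'M[R]_n)
    (u w : V -> 'rV[R]_n) dA du dw x v :
  (forall i j, is_derive x v (fun x => A x i j) (dA i j)) ->
  (forall i, is_derive x v (fun x => u x 0 i) (du i)) ->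
  (forall i, is_derive x v (fun x => w x 0 i) (dw i)) ->
  is_derive x v (fun x => bilin (A x) (u x) (w x))
    (\sum_i \sum_j dA i j * u x 0 i * w x 0 j +
     \sum_i \sum_j A x i j * du i * w x 0 j +
     \sum_i \sum_j A x i j * u x 0 i * dw j).
Proof.
move=> HA Hu Hw; rewrite -!big_split /=.
under eq_bigr do rewrite -!big_split /=.
apply: is_derive_sumf => i; apply: is_derive_sumf => j.
rewrite [X in is_derive _ _ _ X](_ : _ = A x i j * u x 0 i * dw j +
  (A x i j * du i + dA i j * u x 0 i) * w x 0 j); last by ring.
by apply: is_derive_mulf => //; exact: is_derive_mulf.
Qed.

(** Here [A] is the metric, [Dt] and [Dx] are its time and space derivatives, and the [h] functions
    are the first and second derivatives of the coordinates in s and t. The factors 1 and 0 are the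
    time components of the directions of differentiation, t and s respectively. *)
Lemma variation_algebra (A Dt : 'I_n -> 'I_n -> R) (Dx : 'I_n -> 'I_n -> 'I_n -> R)
    (ht hs htt hst hts : 'I_n -> R) :
  hst =1 hts -> (forall i j, A i j = A j i) ->
  \sum_i \sum_j (1 * Dt i j + \sum_l ht l * Dx l i j) * ht i * hs j +
  \sum_i \sum_j A i j * htt i * hs j + \sum_i \sum_j A i j * ht i * hst j -
  2^-1 * (\sum_i \sum_j (0 * Dt i j + \sum_l hs l * Dx l i j) * ht i * ht j +
    \sum_i \sum_j A i j * hts i * ht j + \sum_i \sum_j A i j * ht i * hts j) =
  \sum_j hs j * \sum_i (Dt i j * ht i + A i j * htt i +
    \sum_l (Dx l i j - 2^-1 * Dx j i l) * ht l * ht i).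
Proof.
move=> /funext -> As.
(* Symmetry of [A] makes the two mixed terms of the Lagrangian equal, so that their half-sum cancels
   the mixed term of the momentum. *)
have -> : \sum_i \sum_j A i j * hts i * ht j = \sum_i \sum_j A i j * ht i * hts j.
  rewrite exchange_big; apply: eq_bigr => i _; apply: eq_bigr => j _.
  by rewrite As; ring.
set X := \sum_i \sum_j A i j * ht i * hts j.
set Y := \sum_i \sum_j _ * ht i * ht j.
set Z := \sum_i \sum_j _ * ht i * hs j.
set T := \sum_i \sum_j _ * _ * hs j.
transitivity (Z + T - 2^-1 * Y); first by field.
rewrite [Z]exchange_big [T]exchange_big {}/Y mulr_sumr -big_split /=.
(* The general term of [2^-1 * Y], with indices renamed so that [hs] carries the outer index [j]. *)
pose K i j l := 2^-1 * hs j * Dx j i l * ht i * ht l.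
rewrite (_ : \sum_i (2^-1 * _) = \sum_j \sum_i \sum_l K i j l); last first.
  rewrite exchange_big; apply: eq_bigr => i _; rewrite exchange_big mulr_sumr.
  apply: eq_bigr => j _; rewrite mul0r add0r -mulrA mulr_suml mulr_sumr.
  by apply: eq_bigr => l _; rewrite /K; ring.
rewrite -sumrB; apply: eq_bigr => j _.
rewrite -big_split /= -sumrB mulr_sumr; apply: eq_bigr => i _.
rewrite mul1r mulrDl mulr_suml mulrDl mulr_suml !mulrDr mulr_sumr.
have -> : \sum_l hs j * ((Dx l i j - 2^-1 * Dx j i l) * ht l * ht i) =
    \sum_l ht l * Dx l i j * ht i * hs j - \sum_l K i j l.
  by rewrite -sumrB; apply: eq_bigr => l _; rewrite /K; ring.
ring.
Qed.

Lemma Cinfty_coord m k (W' : normedModType R) (U' : set W') (A : W' -> 'M[R]_(m, k)) i j :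
  Cinfty U' A -> open U' -> Cinfty U' (fun x => A x i j).
Proof.
move=> CA oU' l.
exact: (@Ck_clinear _ _ _ _ _ _ (fun A : 'M[R]_(m, k) => A i j) A oU'
  (clinear_coord i j) (CA l)).
Qed.

Lemma Ck_id {V : normedModType R} k (U : set V) : Ck k U id.
Proof.
case: k => [|k]; first by move=> x _; exact: cvg_id.
split=> [x _|v]; first by have [] := @clinear_id R V x.
rewrite (_ : (fun x => _) = cst v); first exact: Ck_cst.
by apply/funext => x; exact: derive_id.
Qed.

Lemma CkM {V : normedModType R} k (U : set V) (f g : V -> R) : open U ->
  Ck k U f -> Ck k U g -> Ck k U (fun x => f x * g x).
Proof. exact: CkZ. Qed.

Lemma Ck_bilin {V : normedModType R} (U : set V) (A : V -> 'M[R]_n)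
    (u w : V -> 'rV[R]_n) k : open U ->
  Cinfty U A -> Cinfty U u -> Cinfty U w ->
  Ck k U (fun x => bilin (A x) (u x) (w x)).
Proof.
move=> oU CA Cu Cw; apply: Ck_sum => // i _; apply: Ck_sum => // j _.
apply: CkM => //; last exact: Cinfty_coord.
by apply: CkM => //; exact: Cinfty_coord.
Qed.

Variables (W : set (R * 'rV[R]_n)) (G : R * 'rV[R]_n -> 'M[R]_n).
Variables (U : set (R * R)) (h : R * R -> 'rV[R]_n).
Hypothesis oW : open W.
Hypothesis CG : Cinfty W G.
Hypothesis oU : open U.
Hypothesis Ch : Cinfty U h.
Hypothesis hW : forall q, U q -> W (q.2, h q).

Local Notation ds := ((1, 0) : R * R).
Local Notation dt := ((0, 1) : R * R).
Local Notation dx l := ((0, delta_mx 0 l) : R * 'rV[R]_n).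
Local Notation dtime := ((1, 0) : R * 'rV[R]_n).

Definition lagrangian q : R :=
  2^-1 * bilin (G (q.2, h q)) ('D_dt h q) ('D_dt h q).

Definition momentum q : R :=
  bilin (G (q.2, h q)) ('D_dt h q) ('D_ds h q).

(** With L the Lagrangian, this is d/dt (dL/dv^j) - dL/dx^j along the curve t -> h(s, t), with the
    total time derivative expanded. *)
Definition euler_lagrange (j : 'I_n) q : R :=
  \sum_i ('D_dtime (fun p => G p i j) (q.2, h q) * 'D_dt h q 0 i +
    G (q.2, h q) i j * 'D_dt (fun q => 'D_dt h q) q 0 i +
    \sum_l ('D_(dx l) (fun p => G p i j) (q.2, h q) -
        2^-1 * 'D_(dx j) (fun p => G p i l) (q.2, h q)) *
      'D_dt h q 0 l * 'D_dt h q 0 i).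

Lemma derive_coord m k (W' : normedModType R) (A : W' -> 'M[R]_(m, k)) i j x v :
  differentiable A x -> is_derive x v (fun x => A x i j) ('D_v A x i j).
Proof.
move=> dA; have cL := @clinear_coord R m k i j; split.
  apply: diff_derivable.
  apply: (differentiable_comp (g := fun A : 'M[R]_(m, k) => A i j) dA).
  by have [] := cL (A x).
exact: (@clinear_derive _ _ _ _ (fun A : 'M[R]_(m, k) => A i j) A x v cL dA).
Qed.

Lemma differentiable_graph q : U q ->
  differentiable (fun q : R * R => (q.2, h q)) q.
Proof.
move=> Uq; apply: differentiable_pair; last exact: Cinfty_differentiable Uq.
by have [] := @clinear_snd R R R q.
Qed.

(** Chain rule along the graph (t, h): the direction splits into its time component and its
    components along the coordinate axes. *)
Lemma is_derive_metric i j q v : U q ->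
  is_derive q v (fun q => G (q.2, h q) i j)
    (v.2 * 'D_dtime (fun p => G p i j) (q.2, h q) +
     \sum_l 'D_v h q 0 l * 'D_(dx l) (fun p => G p i j) (q.2, h q)).
Proof.
move=> Uq.
have dG : differentiable (fun p => G p i j) (q.2, h q).
  apply: (differentiable_comp (f := G) (g := fun A : 'M[R]_n => A i j)).
    exact: (Cinfty_differentiable CG (hW Uq)).
  exact: differentiable_coord.
have dg := differentiable_graph Uq; have dh := Cinfty_differentiable Ch Uq.
split; first by apply: diff_derivable; exact: (differentiable_comp dg dG).
have d2 : differentiable (@snd R R) q by have [] := @clinear_snd R R R q.
rewrite deriveE; last exact: (differentiable_comp dg dG).
rewrite (diff_comp dg dG) /= diff_pair //.
have [_ ->] := @clinear_snd R R R q.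
rewrite -(deriveE v dh).
have -> : (v.2, 'D_v h q) = v.2 *: dtime + \sum_l 'D_v h q 0 l *: dx l.
  have -> : \sum_l 'D_v h q 0 l *: dx l = (0, \sum_l 'D_v h q 0 l *: delta_mx 0 l).
    elim/big_ind2 : _ => // [x x' y y' -> ->|l _]; first by congr pair; rewrite addr0.
    by congr pair; rewrite scaler0.
  rewrite -row_sum_delta; congr pair; rewrite /= ?scaler0 ?add0r ?addr0 //.
  by rewrite [_ *: _]mulr1.
rewrite linearD linearZ linear_sum -deriveE //; congr (_ + _).
by apply: eq_bigr => l _; rewrite linearZ (deriveE _ dG).
Qed.

Lemma Ck_graph : Cinfty U (fun q : R * R => (q.2, h q)).
Proof.
move=> k; apply: Ck_pair => //.
exact: (Ck_clinear (L := snd) (f := id) oU (@clinear_snd R R R) (Ck_id _ _)).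
Qed.

Lemma Ck_metric : Cinfty U (fun q => G (q.2, h q)).
Proof.
move=> k; apply: (Ck_comp (has_frame_prod has_frame_real (has_frame_rV n)) oU hW
  (f := fun q => (q.2, h q)) (g := G)) => //; exact: Ck_graph.
Qed.

Hypothesis Gsym : forall q, U q -> forall i j, G (q.2, h q) i j = G (q.2, h q) j i.

(* The terms containing the mixed derivative of [h] cancel. *)
Lemma local_first_variation q : U q ->
  'D_dt momentum q - 'D_ds lagrangian q =
  \sum_j 'D_ds h q 0 j * euler_lagrange j q.
Proof.
move=> Uq.
have dD v : differentiable (fun q => 'D_v h q) q.
  exact: (Cinfty_differentiable (Cinfty_derive v Ch) Uq).
have HD u v i := derive_coord (0 : 'I_1) i u (dD v).
have HG v i j := @is_derive_metric i j q v Uq.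
have [_ ->] := is_derive_bilin (HG dt) (HD dt dt) (HD dt ds).
have [D E] := is_derive_bilin (HG ds) (HD ds dt) (HD ds dt).
rewrite deriveMl // {}E.
have C i : 'D_dt (fun q => 'D_ds h q) q 0 i = 'D_ds (fun q => 'D_dt h q) q 0 i.
  by have /rowP/(_ i) := derive_comm_rV ds dt oU Uq (Ch 2).
exact: (variation_algebra (A := fun i j => G (q.2, h q) i j) _ _ _ _ _ C (Gsym Uq)).
Qed.

Lemma Cinfty_lagrangian : Cinfty U lagrangian.
Proof.
move=> k; apply: (CkM oU); first exact: Ck_cst.
by apply: Ck_bilin => //; [exact: Ck_metric|exact: Cinfty_derive|exact: Cinfty_derive].
Qed.

Lemma Cinfty_momentum : Cinfty U momentum.
Proof.
move=> k.
by apply: Ck_bilin => //; [exact: Ck_metric|exact: Cinfty_derive|exact: Cinfty_derive].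
Qed.

Lemma Cinfty_euler_lagrange j : Cinfty U (euler_lagrange j).
Proof.
move=> k.
have CD v i l : Ck k U (fun q => 'D_v (fun p => G p i l) (q.2, h q)).
  exact: (Ck_comp (has_frame_prod has_frame_real (has_frame_rV n)) oU hW
    (f := fun q => (q.2, h q)) (g := fun p => 'D_v (fun p => G p i l) p)
    (Ck_graph k) (Cinfty_derive v (Cinfty_coord i l CG oW) k)).
have Ct i : Ck k U (fun q => 'D_dt h q 0 i).
  exact: (Cinfty_coord 0 i (Cinfty_derive dt Ch) oU).
have Ctt i : Ck k U (fun q => 'D_dt (fun q => 'D_dt h q) q 0 i).
  exact: (Cinfty_coord 0 i (Cinfty_derive dt (Cinfty_derive dt Ch)) oU).
apply: Ck_sum => // i _; apply: CkD => //.
  apply: CkD => //; first by apply: CkM.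
  by apply: CkM => //; exact: (Cinfty_coord i j (Ck_metric) oU).
apply: Ck_sum => // l _; apply: CkM => //; apply: CkM => //.
rewrite (_ : (fun x => _) = fun q => 'D_(dx l) (fun p => G p i j) (q.2, h q) +
  (- 2^-1) * 'D_(dx j) (fun p => G p i l) (q.2, h q)); last first.
  by apply/funext => x; rewrite mulNr.
by apply: CkD => //; apply: CkM => //; exact: Ck_cst.
Qed.

End LocalVariation.

(** * One-sided derivatives and integrals over a strip *)

Lemma derive_comp {R : realType} {U V W : normedModType R} (f : U -> V)
    (g : V -> W) x v : differentiable f x -> differentiable g (f x) ->
  'D_v (g \o f) x = 'D_('D_v f x) g (f x).
Proof.
move=> df dg; have dgf := differentiable_comp df dg.
by rewrite (deriveE _ dgf) (diff_comp df dg) (deriveE _ df) (deriveE _ dg).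
Qed.

Section DeriveWithin.
Context {R : realType} {W : normedModType R}.
Variables (a b : R).
Hypothesis ab : a < b.

(** Limits are unique only along a proper filter. As [a < b], every time of the interval is
    approached from the right if it is below [b], and from the left otherwise. *)
Lemma dnbhs_within_itv_proper (t : R) : t \in `[a, b] ->
  ProperFilter (within (fun h => `[a, b]%classic (h + t)) (0 : R)^').
Proof.
rewrite in_itv /= => /andP[at_ tb]; apply: Build_ProperFilter_ex => P.
rewrite /within /= => /nbhs_ballP[e /= e0 He].
have [tb'|bt] := ltP t b.
  pose h := Num.min (e / 2) (b - t).
  have h0 : 0 < h by rewrite lt_min divr_gt0 //= subr_gt0.
  exists h; apply: He; rewrite /= ?gt_eqF //.
    rewrite /ball /= sub0r normrN gtr0_norm // gt_min ltr_pdivrMr // ltr_pMr //.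
    by rewrite ltr1n.
  rewrite in_itv /=; apply/andP; split; first by rewrite (le_trans at_) ?lerDr ?(ltW h0).
  by rewrite -lerBrDr ge_min lexx orbT.
pose h := Num.min (e / 2) (t - a).
have h0 : 0 < h.
  by rewrite lt_min divr_gt0 //= subr_gt0 (lt_le_trans ab).
exists (- h); apply: He; rewrite /= ?oppr_eq0 ?gt_eqF //.
  rewrite /ball /= sub0r opprK gtr0_norm // gt_min ltr_pdivrMr // ltr_pMr //.
  by rewrite ltr1n.
rewrite in_itv /= addrC lerBrDr -lerBrDl ge_min lexx orbT /=.
by rewrite (le_trans _ tb) // gerBl ltW.
Qed.

(** This is how one-sided derivatives are computed: [g] is typically a smooth extension of [f]
    beyond the endpoints, and restricting the filter keeps the limit of its difference quotient. *)
Lemma derive_withinE (f g : R -> W) t : t \in `[a, b] ->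
  (\forall u \near t, u \in `[a, b] -> f u = g u) -> derivable g t 1 ->
  derive_within `[a, b] f t = 'D_1 g t.
Proof.
move=> tab fg dg; have PF := dnbhs_within_itv_proper tab.
apply: cvg_lim => //.
have Hg : (h^-1 *: (g (h + t) - g t)) @[h -->
    within (fun h => `[a, b]%classic (h + t)) 0^'] --> 'D_1 g t.
  apply: cvg_trans; first apply: cvg_app; first exact: cvg_within.
  have -> : (fun h => h^-1 *: (g (h + t) - g t)) =
      (fun h => h^-1 *: ((g \o shift t) (h *: 1) - g t)).
    by apply/funext => h; rewrite /= [_ *: 1]mulr1.
  exact: dg.
apply: cvg_trans Hg; apply: near_eq_cvg.
have fgt : f t = g t by exact: (nbhs_singleton fg).
rewrite near_withinE; apply: nbhs_dnbhs.
have : \forall h \near (0 : R), h + t \in `[a, b] -> f (h + t) = g (h + t).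
  by move: fg; rewrite (near_shift 0 t) /=; apply: filterS => h /=; rewrite subr0.
by apply: filterS => h H ht; rewrite fgt H.
Qed.

End DeriveWithin.

Section SmoothOn.
Context {R : realType}.

Lemma smooth_on_continuous {V W : normedModType R} (A : set V) (f : V -> W) :
  smooth_on A f -> {within A, continuous f}.
Proof.
move=> sf; apply/subspace_continuousP => x Ax.
have [U [h [oU Ux Ch hf]]] := sf x Ax.
have ch : h @ within A (nbhs x) --> f x.
  by rewrite -(hf x Ux Ax); apply: cvg_within_filter; exact: Cinfty_continuous Ch Ux.
apply: cvg_trans ch.
apply: near_eq_cvg; rewrite near_withinE.
have : nbhs x U by exact: open_nbhs_nbhs.
by apply: filterS => y Uy Ay; exact: hf.
Qed.

End SmoothOn.

Section StripIntegral.
Context {R : realType}.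
Variables (a b e : R).
Hypotheses (ab : a < b) (e0 : 0 < e).
Local Notation strip := ((`]- e, e[ : set R) `*` (`[a, b] : set R)).
Local Notation mu := (@lebesgue_measure R).
Local Notation ds := ((1, 0) : R * R).
Local Notation dt := ((0, 1) : R * R).

Lemma slice_continuous {T : topologicalType} (f : R * R -> T) s : s \in `]- e, e[ ->
  {within strip, continuous f} ->
  {within `[a, b], continuous (fun t => f (s, t))}.
Proof.
move=> se /subspace_continuousP cf; apply/subspace_continuousP => t tab.
have st : strip (s, t) by split.
apply: cvg_trans (cf _ st) => P; rewrite /within /= => HP.
have [/= [A B] [/= HA HB] HAB] := HP.
apply: filterS HB => u Bu uab; apply: HAB => //; split => //.
exact: (nbhs_singleton HA).
Qed.

(** The parameter s runs through an open interval, hence a two-sided derivative; the time runs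
    through a closed one, hence [derive_within] in [deriv2]. *)
Definition deriv1 (f : R * R -> R) q : R := 'D_1 (fun s => f (s, q.2)) q.1.
Definition deriv2 (f : R * R -> R) q : R :=
  derive_within `[a, b] (fun t => f (q.1, t)) q.2.

Lemma near_slice1 (U : set (R * R)) q : open U -> U q -> strip q ->
  \forall s \near q.1, U (s, q.2) /\ s \in `]- e, e[.
Proof.
move=> oU Uq [/= q1 q2].
have : nbhs q U by exact: open_nbhs_nbhs.
move=> [/= [A B] [/= HA HB] HAB].
have HE : \forall s \near q.1, s \in `]- e, e[ by exact: near_in_itvoo.
apply: filterS (filterI HA HE) => s [As se]; split => //; apply: HAB; split => //=.
exact: (nbhs_singleton HB).
Qed.

Lemma near_slice2 (U : set (R * R)) q : open U -> U q ->
  \forall t \near q.2, U (q.1, t).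
Proof.
move=> oU Uq; have : nbhs q U by exact: open_nbhs_nbhs.
move=> [/= [A B] [/= HA HB] HAB].
apply: filterS HB => t Bt; apply: HAB; split => //=.
exact: (nbhs_singleton HA).
Qed.

Lemma derive_slice1 {W : normedModType R} (h : R * R -> W) q :
  'D_1 (fun s => h (s, q.2)) q.1 = 'D_ds h q /\
  (derivable h q ds -> derivable (fun s => h (s, q.2)) q.1 1).
Proof.
have := @derive_line R _ W h (fun s => (s, q.2)) ds q.1.
case: q => q1 q2 /=; case=> [l|D ->] //.
by congr pair; rewrite /= ?scaler0 ?add0r // [_ *: _]mulr1.
Qed.

Lemma derive_slice2 {W : normedModType R} (h : R * R -> W) q :
  'D_1 (fun t => h (q.1, t)) q.2 = 'D_dt h q /\
  (derivable h q dt -> derivable (fun t => h (q.1, t)) q.2 1).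
Proof.
have := @derive_line R _ W h (fun t => (q.1, t)) dt q.2.
case: q => q1 q2 /=; case=> [l|D ->] //.
by congr pair; rewrite /= ?scaler0 ?add0r // [_ *: _]mulr1.
Qed.

Section Agree.
Context {W : normedModType R}.
Variables (U : set (R * R)) (h f : R * R -> W).
Hypotheses (oU : open U) (Ch : Cinfty U h).
Hypothesis hf : forall q, U q -> strip q -> h q = f q.

(** Moving s slightly stays in the strip, so [h] and [f] agree on a full neighbourhood within the
    slice; at the ends of the time interval this fails for the other variable. *)
Lemma deriv1_agree q : U q -> strip q ->
  derivable (fun s => f (s, q.2)) q.1 1 /\
  'D_1 (fun s => f (s, q.2)) q.1 = 'D_ds h q.
Proof.
move=> Uq Sq; have [E D] := @derive_slice1 W h q.
have N : \forall s \near q.1, h (s, q.2) = f (s, q.2).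
  apply: filterS (near_slice1 oU Uq Sq) => s [Us se]; apply: hf => //.
  by case: Sq; split.
split; last by rewrite -E; apply/esym; exact: near_eq_derive.
apply: near_eq_derivable N _; apply: D; apply: diff_derivable.
exact: Cinfty_differentiable Uq.
Qed.

Lemma deriv2_agree q : U q -> strip q ->
  derive_within `[a, b] (fun t => f (q.1, t)) q.2 = 'D_dt h q.
Proof.
move=> Uq [q1 q2]; have [<- D] := @derive_slice2 W h q.
apply: (derive_withinE ab) => //.
  apply: filterS (near_slice2 oU Uq) => t Ut tab; apply/esym.
  by apply: hf => //; split.
by apply: D; apply: diff_derivable; exact: Cinfty_differentiable Uq.
Qed.

End Agree.

Lemma smooth_on_deriv1 f : smooth_on strip f -> smooth_on strip (deriv1 f).
Proof.
move=> sf q Sq; have [U [h [oU Uq Ch hf]]] := sf q Sq.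
exists U, (fun x => 'D_ds h x); split => //; first exact: Cinfty_derive.
by move=> y Uy Sy; have [_ <-] := deriv1_agree oU Ch hf Uy Sy.
Qed.

Lemma smooth_on_deriv2 f : smooth_on strip f -> smooth_on strip (deriv2 f).
Proof.
move=> sf q Sq; have [U [h [oU Uq Ch hf]]] := sf q Sq.
exists U, (fun x => 'D_dt h x); split => //; first exact: Cinfty_derive.
by move=> y Uy Sy; rewrite -(deriv2_agree oU Ch hf Uy Sy).
Qed.

Lemma strip0 t : t \in `[a, b] -> strip (0, t).
Proof. by move=> tab; split => //=; rewrite in_itv /= oppr_lt0 e0. Qed.

Lemma slice_integrable f s : s \in `]- e, e[ -> smooth_on strip f ->
  mu.-integrable `[a, b] (EFin \o (fun t => f (s, t))).
Proof.
move=> se sf; apply: continuous_compact_integrable; first exact: segment_compact.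
exact: (slice_continuous se (smooth_on_continuous sf)).
Qed.

(** Differentiation under the integral sign, dominated by a constant. *)
Lemma derive_integral f : smooth_on strip f ->
  is_derive (0 : R) 1 (fun s => \int[mu]_(t in `[a, b]) f (s, t))
    (\int[mu]_(t in `[a, b]) deriv1 f (0, t)).
Proof.
(* The range of s is halved to get a compact strip, on which the continuous [deriv1 f] is bounded;
   on the open strip it may be unbounded. *)
move=> sf; pose K := (`[- (e / 2), e / 2] : set R) `*` (`[a, b] : set R).
have e2 : e / 2 < e by rewrite ltr_pdivrMr // ltr_pMr // ltr1n.
have sK : K `<=` strip.
  move=> [s t] [/= sK tK]; split => //=; move: sK; rewrite /= !in_itv /=.
  by move=> /andP[es se]; rewrite (le_lt_trans se) // (lt_le_trans _ es) // ltrN2.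
have cK : compact K by apply: compact_setX; exact: segment_compact.
have cf := smooth_on_continuous (smooth_on_deriv1 sf).
have [M [_ HM]] := compact_bounded (continuous_compact (continuous_subspaceW sK cf) cK).
(* Boundedness provides bounds strictly above [M] only; this choice is also nonnegative. *)
pose C := `|M| + 1.
have HC s t : `]- (e / 2), (e / 2)[%classic s -> `[a, b]%classic t ->
    `|deriv1 f (s, t)| <= C.
  move=> sI tI; apply: HM; first by rewrite (le_lt_trans (ler_norm M)) // ltrDl.
  exists (s, t) => //; split => //=; move: sI; rewrite /= !in_itv /=.
  by move=> /andP[? ?]; rewrite !ltW.
have I0 : `]- (e / 2), (e / 2)[%classic (0 : R).
  by rewrite /= in_itv /= oppr_lt0 divr_gt0.
have sI s : `]- (e / 2), (e / 2)[%classic s -> s \in `]- e, e[.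
  rewrite /= !in_itv /= => /andP[es se].
  by rewrite (lt_trans se) // (lt_trans _ es) // ltrN2.
have mI : measurable (`[a, b]%classic : set R) by exact: measurable_itv.
have intf s : `]- (e / 2), (e / 2)[%classic s ->
    mu.-integrable `[a, b] (EFin \o (fun t => f (s, t))).
  by move=> /sI se; exact: slice_integrable.
have df s t : `]- (e / 2), (e / 2)[%classic s -> `[a, b]%classic t ->
    derivable (fun s => f (s, t)) s 1.
  move=> /sI se tab; have Sq : strip (s, t) by split.
  have [U [h [oU Uq Ch hf]]] := sf _ Sq.
  by have [] := deriv1_agree oU Ch hf Uq Sq.
have C0 : forall y : R, 0 <= C by move=> _; rewrite addr_ge0.
have intC : mu.-integrable `[a, b] (EFin \o (fun=> C)).
  apply: continuous_compact_integrable; first exact: segment_compact.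
  exact: cst_continuous.
have Hbound s t : `]- (e / 2), (e / 2)[%classic s -> `[a, b]%classic t ->
    `|partial1of2 (fun s t => f (s, t)) s t| <= C.
  by rewrite partial1of2E; exact: HC.
have Cv := @cvg_differentiation_under_integral R _ _ mu (fun s t => f (s, t))
  `[a, b]%classic mI 0 (- (e / 2)) (e / 2) I0 intf df (fun=> C) C0 intC Hbound.
have -> : \int[mu]_(t in `[a, b]) deriv1 f (0, t) =
    \int[mu]_(t in `[a, b]) partial1of2 (fun s t => f (s, t)) 0 t.
  by apply: eq_Rintegral => t _; rewrite partial1of2E.
split.
  apply/cvg_ex; eexists; move: Cv; rewrite /= => Cv.
  under eq_fun do rewrite [_ *: 1]mulr1; exact: Cv.
apply: cvg_lim => //; under eq_fun do rewrite /= [_ *: 1]mulr1; exact: Cv.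
Qed.

(* [deriv2 m] integrates to 0 because [m] vanishes at both endpoints. *)
Lemma derive_integral_eq f m : smooth_on strip f -> smooth_on strip m ->
  m (0, a) = 0 -> m (0, b) = 0 ->
  is_derive (0 : R) 1 (fun s => \int[mu]_(t in `[a, b]) f (s, t))
    (- \int[mu]_(t in `[a, b]) (deriv2 m (0, t) - deriv1 f (0, t))).
Proof.
move=> sf sm ma mb.
have O_in : (0 : R) \in `]- e, e[ by rewrite in_itv /= oppr_lt0 e0.
have mI : measurable (`[a, b]%classic : set R) by exact: measurable_itv.
rewrite RintegralB //; last 2 first.
- exact: (slice_integrable O_in (smooth_on_deriv2 sm)).
- exact: (slice_integrable O_in (smooth_on_deriv1 sf)).
(* Inside the interval [deriv2 m] is an ordinary derivative, as the fundamental theorem of calculus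
   demands; at the endpoints continuity of [m] suffices. *)
have dm t : t \in `]a, b[ -> is_derive t 1 (fun t => m (0, t)) (deriv2 m (0, t)).
  move=> tab; have tab' : t \in `[a, b].
    by move: tab; rewrite !in_itv /= => /andP[? ?]; rewrite !ltW.
  have Sq := strip0 tab'; have [U [h [oU Uq Ch hm]]] := sm _ Sq.
  have [E D] := derive_slice2 h (0, t).
  rewrite /deriv2 (deriv2_agree oU Ch hm Uq Sq) -E.
  apply: (@near_eq_is_derive _ _ _ (fun t => h (0, t))).
    have N1 := near_slice2 oU Uq.
    have N2 : \forall u \near t, u \in `]a, b[ by exact: near_in_itvoo.
    apply: filterS (filterI N1 N2) => u [Uu uab]; apply: hm => //.
    apply: strip0; move: uab.
    by rewrite !in_itv /= => /andP[? ?]; rewrite !ltW.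
  apply: derivableP; apply: D; apply: diff_derivable.
  exact: Cinfty_differentiable Uq.
have -> : \int[mu]_(t in `[a, b]) deriv2 m (0, t) = 0.
  have [m1 m2 m3] := (continuous_within_itvP (fun t => m (0, t)) ab).1
    (slice_continuous O_in (smooth_on_continuous sm)).
  rewrite /Rintegral (@continuous_FTC2 _ _ (fun t => m (0, t)) _ _ ab) //.
  - by rewrite ma mb -EFinB subrr.
  - exact: (slice_continuous O_in (smooth_on_continuous (smooth_on_deriv2 sm))).
  - by split => // t tab; have [] := dm t tab.
  - by move=> t tab; rewrite derive1E; have [_ ->] := dm t tab.
rewrite sub0r opprK; exact: derive_integral.
Qed.

(** By continuity [f] is at least [f t0 / 2] on an interval of length [r + r] around [t0], which
    bounds the integral from below. *)
Lemma continuous_pos_integral_neq0 (f : R -> R) t0 :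
  {within `[a, b], continuous f} -> (forall t, t \in `[a, b] -> 0 <= f t) ->
  t0 \in `]a, b[ -> 0 < f t0 -> \int[mu]_(t in `[a, b]) f t != 0.
Proof.
move=> cf f0 t0ab ft0.
have intf : mu.-integrable `[a, b] (EFin \o f).
  by apply: continuous_compact_integrable => //; exact: segment_compact.
have [r r0 Hr] : exists2 r, 0 < r & forall t, t \in `[t0 - r, t0 + r] ->
    t \in `[a, b] /\ f t0 / 2 <= f t.
  have [cf' _ _] := (continuous_within_itvP f ab).1 cf.
  have N1 : \forall t \near t0, f t0 / 2 < f t.
    have half : f t0 / 2 < f t0 by rewrite ltr_pdivrMr // ltr_pMr // ltr1n.
    exact: (@cvgr_gt _ _ (nbhs t0) _ f (f t0) (cf' t0 t0ab) _ half).
  have N2 : \forall t \near t0, t \in `]a, b[ by exact: near_in_itvoo.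
  have [e' /= e'0 He'] := (nbhs_ballP _ _).1 (filterI N1 N2).
  exists (e' / 2) => [|t]; first by rewrite divr_gt0.
  rewrite in_itv /= => /andP[t1 t2].
  have e2' : e' / 2 < e' by rewrite ltr_pdivrMr // ltr_pMr // ltr1n.
  have /He'[/ltW ? tab] : ball t0 e' t.
    rewrite /ball /= ltr_norml ltrBrDl ltrBlDl; apply/andP; split; lra.
  split => //; move: tab; rewrite !in_itv /= => /andP[? ?]; by rewrite !ltW.
have mD : measurable (`[t0 - r, t0 + r]%classic : set R) by exact: measurable_itv.
have mI : measurable (`[a, b]%classic : set R) by exact: measurable_itv.
have sD : `[t0 - r, t0 + r]%classic `<=` `[a, b]%classic.
  by move=> t /= /Hr[].
have mf := measurable_int _ intf.
have H : ((f t0 / 2 * (r + r))%:E <= \int[mu]_(t in `[a, b]) (f t)%:E)%E.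
  apply: (@le_trans _ _
    (\int[mu]_(t in `[(t0 - r)%R, (t0 + r)%R]) (f t)%:E)%E); last first.
    apply: ge0_subset_integral => //= t tab; rewrite lee_fin; exact: f0.
  have -> : ((f t0 / 2 * (r + r))%:E =
      \int[mu]_(t in `[(t0 - r)%R, (t0 + r)%R]) (cst (f t0 / 2)%:E) t)%E.
    rewrite integral_cst //= lebesgue_measure_itv /= lte_fin ifT; last by lra.
    by rewrite -EFinB -EFinM; congr (_%:E); ring.
  apply: ge0_le_integral => //.
  - by move=> t tD; rewrite lee_fin divr_ge0 // ltW.
  - exact: measurable_funS mf.
  - by move=> t /Hr[_]; rewrite lee_fin.
(* The real-valued integral is 0 by convention when the extended one is infinite, so finiteness is
   needed before concluding. *)
have fi : (\int[mu]_(t in `[a, b]) (f t)%:E)%E \is a fin_num.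
  by apply: integrable_fin_num intf; exact: measurable_itv.
rewrite gt_eqF // /Rintegral -lte_fin fineK //; apply: lt_le_trans H.
by rewrite lte_fin mulr_gt0 ?divr_gt0 ?addr_gt0.
Qed.

End StripIntegral.

(** * Energy of a variation *)

Section ChartRepresentation.
Context {R : realType} {n : nat} {M : manifold R n}.
Variables (g : riemannian_metric M) (a b e : R) (H : R * R -> M).
Hypotheses (ab : a < b).
Local Notation strip := ((`]- e, e[ : set R) `*` (`[a, b] : set R)).
Local Notation ds := ((1, 0) : R * R).
Local Notation dt := ((0, 1) : R * R).
Local Notation image c := (chart_coord c @` chart_dom c).
Hypothesis sH : smooth_map strip H.

Lemma open_sub_nbhs {T : topologicalType} (x : T) (N : set T) :
  nbhs x N -> exists U, [/\ open U, U x & U `<=` N].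
Proof. by rewrite nbhsE => -[U [oU Ux] UN]; exists U. Qed.

Lemma within_continuous_near {T S : topologicalType} (A : set T) (f : T -> S)
    (B : set S) x : {within A, continuous f} -> A x -> open B -> B (f x) ->
  exists U, [/\ open U, U x & forall y, U y -> A y -> B (f y)].
Proof.
move=> /subspace_continuousP cf Ax oB Bfx.
have nB : nbhs (f x) B by exact: open_nbhs_nbhs.
have [U [oU Ux UB]] := open_sub_nbhs (cf x Ax _ nB).
by exists U.
Qed.

(** The neighbourhood is shrunk twice: on the strip [H] must stay in the chart, and [h] must stay in
    the chart image also off the strip, where it is not tied to [H], so that the metric can be
    composed with [h]. *)
Lemma chart_rep (c : chart R n M) q : atlas M c -> strip q -> chart_dom c (H q) ->
  exists (U : set (R * R)) (h : R * R -> 'rV[R]_n),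
    [/\ open U, U q, Cinfty U h,
      (forall p, U p -> strip p -> chart_dom c (H p) /\ h p = chart_coord c (H p)) &
      forall p, U p -> image c (h p)].
Proof.
move=> ac Sq cq; have [cH /(_ c ac q) sc] := sH.
have [|U [h [oU Uq Ch hE]]] := sc; first by split.
have [U1 [oU1 U1q U1c]] := within_continuous_near cH Sq (chart_open c) cq.
have hq : h q = chart_coord c (H q) by apply: hE.
have hcq : image c (h q) by rewrite hq; exists (H q).
have : nbhs q (h @^-1` image c).
  apply: (Cinfty_continuous Ch Uq); apply: open_nbhs_nbhs; split => //.
  exact: chart_image_open.
move=> /open_sub_nbhs[U2 [oU2 U2q U2c]].
exists (U `&` (U1 `&` U2)), h; split.
- by apply: openI => //; exact: openI.
- by [].
- by move=> k; apply: Ck_sub (Ch k) => p [].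
- move=> p [Up [U1p _]] Sp; have cp := U1c p U1p Sp; split => //.
  by apply: hE.
- by move=> p [_ [_ /U2c]].
Qed.

Definition vel c q : 'rV[R]_n := velocity a b (fun t => H (q.1, t)) c q.2.
Definition svel c q : 'rV[R]_n :=
  'D_1 (fun s => chart_coord c (H (s, q.2))) q.1.

Lemma vel_rep c U h q : open U -> Cinfty U h ->
  (forall p, U p -> strip p -> h p = chart_coord c (H p)) ->
  U q -> strip q -> vel c q = 'D_dt h q.
Proof.
by move=> oU Ch hE Uq Sq; exact: (deriv2_agree ab oU Ch hE Uq Sq).
Qed.

Lemma svel_rep c U h q : open U -> Cinfty U h ->
  (forall p, U p -> strip p -> h p = chart_coord c (H p)) ->
  U q -> strip q -> svel c q = 'D_ds h q.
Proof.
move=> oU Ch hE Uq Sq.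
by have [_] := deriv1_agree oU Ch hE Uq Sq.
Qed.

(** On the strip the coordinates in [d] are the transition map applied to those in [c]. The chain
    rule is applied to the transition map composed with the extension [h], whose derivatives are the
    components in [c]. *)
Lemma vel_change c d q : atlas M c -> atlas M d -> strip q ->
  chart_dom c (H q) -> chart_dom d (H q) ->
  vel d q = tangent_change c d (H q) (vel c q) /\
  svel d q = tangent_change c d (H q) (svel c q).
Proof.
move=> ac ad Sq cq dq.
have [U [h [oU Uq Ch hE _]]] := chart_rep ac Sq cq.
have [V [k [oV Vq Ck_ kE _]]] := chart_rep ad Sq dq.
pose D := chart_coord c @` (chart_dom c `&` chart_dom d).
have hq : h q = chart_coord c (H q) by have [] := hE q Uq Sq.
have Dq : D (h q) by rewrite hq; exists (H q).
have Ctau : Cinfty D (transition c d) := atlas_smooth ac ad.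
have dtau := Cinfty_differentiable Ctau Dq.
have dh := Cinfty_differentiable Ch Uq.
have kh p : (U `&` V) p -> strip p -> k p = transition c d (h p).
  move=> [Up Vp] Sp; have [cp ->] := hE p Up Sp; have [_ ->] := kE p Vp Sp.
  by rewrite /transition /= chart_coordK.
have E v : 'D_v (transition c d \o h) q = tangent_change c d (H q) ('D_v h q).
  by rewrite /tangent_change -hq; exact: (derive_comp v dh dtau).
have oUV := openI oU oV; have UVq : (U `&` V) q by [].
have dth v : derivable (transition c d \o h) q v.
  by apply: diff_derivable; exact: differentiable_comp.
have hE' p : U p -> strip p -> h p = chart_coord c (H p).
  by move=> Up Sp; have [] := hE p Up Sp.
have kE' p : V p -> strip p -> k p = chart_coord d (H p).
  by move=> Vp Sp; have [] := kE p Vp Sp.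
rewrite (vel_rep oU Ch hE' Uq Sq) (svel_rep oU Ch hE' Uq Sq) -!E; split.
  have [<- Dt] := derive_slice2 (transition c d \o h) q.
  apply: (derive_withinE ab); [by case: Sq| |exact: Dt].
  apply: filterS (near_slice2 oUV UVq) => t [Ut Vt] tab.
  have St : strip (q.1, t) by case: Sq; split.
  exact: etrans (esym (kE' _ Vt St)) (kh _ (conj Ut Vt) St).
have [<- _] := derive_slice1 (transition c d \o h) q.
apply: near_eq_derive.
apply: filterS (near_slice1 oUV UVq Sq) => s [[Us Vs] se].
have St : strip (s, q.2) by case: Sq; split.
exact: etrans (esym (kE' _ Vs St)) (kh _ (conj Us Vs) St).
Qed.

(** The chart picked by [chart_at] may jump from point to point, so smoothness of this function and
    of [pairing] only shows after passing to a chart fixed near [q]. *)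
Definition kinetic q : R := 2^-1 * bilin (gcomp g (chart_at (H q)) q.2 (H q))
  (vel (chart_at (H q)) q) (vel (chart_at (H q)) q).

Definition pairing q : R := bilin (gcomp g (chart_at (H q)) q.2 (H q))
  (vel (chart_at (H q)) q) (svel (chart_at (H q)) q).

Lemma chart_atP x : atlas M (chart_at x) /\ chart_dom (chart_at x) x.
Proof. by rewrite /chart_at; case: cid2. Qed.

Lemma bilin_vel_chart c d q : atlas M c -> atlas M d -> strip q ->
  chart_dom c (H q) -> chart_dom d (H q) ->
  bilin (gcomp g d q.2 (H q)) (vel d q) (vel d q) =
    bilin (gcomp g c q.2 (H q)) (vel c q) (vel c q) /\
  bilin (gcomp g d q.2 (H q)) (vel d q) (svel d q) =
    bilin (gcomp g c q.2 (H q)) (vel c q) (svel c q).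
Proof.
move=> ac ad Sq cq dq; have [-> ->] := vel_change ac ad Sq cq dq.
by split; rewrite -gcomp_change.
Qed.

Lemma kinetic_chart c q : atlas M c -> strip q -> chart_dom c (H q) ->
  kinetic q = 2^-1 * bilin (gcomp g c q.2 (H q)) (vel c q) (vel c q).
Proof.
move=> ac Sq cq; have [ad dq] := chart_atP (H q).
by have [E _] := bilin_vel_chart ac ad Sq cq dq; rewrite /kinetic E.
Qed.

Lemma pairing_chart c q : atlas M c -> strip q -> chart_dom c (H q) ->
  pairing q = bilin (gcomp g c q.2 (H q)) (vel c q) (svel c q).
Proof.
move=> ac Sq cq; have [ad dq] := chart_atP (H q).
by have [_ E] := bilin_vel_chart ac ad Sq cq dq; rewrite /pairing E.
Qed.

Definition metric_in (c : chart R n M) (p : R * 'rV[R]_n) : 'M[R]_n :=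
  gcomp g c p.1 (chart_point c p.2).

Definition metric_dom (c : chart R n M) : set (R * 'rV[R]_n) :=
  [set: R] `*` image c.

Lemma open_metric_dom c : open (metric_dom c).
Proof.
rewrite openE => -[t y] [_ /= iy]; exists ([set: R], image c); last by [].
by split; [exact: filterT|apply: open_nbhs_nbhs; split=> //; exact: chart_image_open].
Qed.

Lemma Cinfty_metric_in c : atlas M c -> Cinfty (metric_dom c) (metric_in c).
Proof. exact: gcomp_smooth. Qed.

Lemma metric_in_sym c p i j : atlas M c -> metric_dom c p ->
  metric_in c p i j = metric_in c p j i.
Proof.
move=> ac [_ [x cx E]]; rewrite /metric_in -E chart_coordK //.
exact: gcomp_sym.
Qed.

Lemma chart_first_variation c q : atlas M c -> strip q -> chart_dom c (H q) ->
  exists (U : set (R * R)) (h : R * R -> 'rV[R]_n),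
    [/\ [/\ open U, U q, Cinfty U h &
          forall p, U p -> strip p -> chart_dom c (H p) /\ h p = chart_coord c (H p)],
        forall p, U p -> metric_dom c (p.2, h p),
        forall p, U p -> strip p ->
          kinetic p = lagrangian (metric_in c) h p /\
          pairing p = momentum (metric_in c) h p &
        forall p, U p -> strip p ->
          vel c p = 'D_dt h p /\ svel c p = 'D_ds h p].
Proof.
move=> ac Sq cq; have [U [h [oU Uq Ch hE hI]]] := chart_rep ac Sq cq.
have hE' p : U p -> strip p -> h p = chart_coord c (H p).
  by move=> Up Sp; have [] := hE p Up Sp.
have vE p : U p -> strip p -> vel c p = 'D_dt h p /\ svel c p = 'D_ds h p.
  by move=> Up Sp; split; [exact: (vel_rep oU Ch hE')|exact: (svel_rep oU Ch hE')].
exists U, h; split; [by [] | | |exact: vE].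
  by move=> p Up; split; [exact: I|exact: hI].
move=> p Up Sp; have [cp hp] := hE p Up Sp; have [v1 v2] := vE p Up Sp.
rewrite (kinetic_chart ac Sp cp) (pairing_chart ac Sp cp) /lagrangian /momentum.
by rewrite -v1 -v2 /metric_in /= hp (chart_coordK cp); split; reflexivity.
Qed.

Lemma smooth_kinetic : smooth_on strip kinetic.
Proof.
move=> q Sq; have [ac cq] := chart_atP (H q).
have [U [h [[oU Uq Ch hE] hI E _]]] := chart_first_variation ac Sq cq.
exists U, (lagrangian (metric_in (chart_at (H q))) h).
split; [exact: oU|exact: Uq| |by move=> p Up Sp; have [/esym] := E p Up Sp].
exact: (Cinfty_lagrangian (Cinfty_metric_in ac) oU Ch hI).
Qed.

Lemma smooth_pairing : smooth_on strip pairing.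
Proof.
move=> q Sq; have [ac cq] := chart_atP (H q).
have [U [h [[oU Uq Ch hE] hI E _]]] := chart_first_variation ac Sq cq.
exists U, (momentum (metric_in (chart_at (H q))) h).
split; [exact: oU|exact: Uq| |by move=> p Up Sp; have [_ /esym] := E p Up Sp].
exact: (Cinfty_momentum (Cinfty_metric_in ac) oU Ch hI).
Qed.

(** The formula for extensions transfers to the chart-free functions, since [deriv1] and [deriv2]
    can be computed on any local smooth extension. *)
Lemma deriv_pairing_kinetic c q : atlas M c -> strip q -> chart_dom c (H q) ->
  exists (U : set (R * R)) (h : R * R -> 'rV[R]_n),
    [/\ [/\ open U, U q, Cinfty U h &
          forall p, U p -> strip p -> chart_dom c (H p) /\ h p = chart_coord c (H p)],
        forall p, U p -> metric_dom c (p.2, h p),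
        forall p, U p -> strip p ->
          vel c p = 'D_dt h p /\ svel c p = 'D_ds h p &
        forall p, U p -> strip p ->
          deriv2 a b pairing p - deriv1 kinetic p =
          \sum_j svel c p 0 j * euler_lagrange (metric_in c) h j p].
Proof.
move=> ac Sq cq.
have [U [h [[oU Uq Ch hE] hI E vE]]] := chart_first_variation ac Sq cq.
exists U, h; split; [by [] |exact: hI|exact: vE|move=> p Up Sp].
have [_ ->] := vE p Up Sp.
have CG := Cinfty_metric_in ac.
rewrite -(local_first_variation CG oU Ch hI _ Up); last first.
  by move=> r Ur i j; apply: metric_in_sym => //; exact: hI.
have E1 : deriv2 a b pairing p = 'D_dt (momentum (metric_in c) h) p.
  apply: (deriv2_agree ab oU (Cinfty_momentum CG oU Ch hI) _ Up Sp) => r Ur Sr.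
  by have [_ ->] := E r Ur Sr.
have E2 : deriv1 kinetic p = 'D_ds (lagrangian (metric_in c) h) p.
  have K r : U r -> strip r -> lagrangian (metric_in c) h r = kinetic r.
    by move=> Ur Sr; have [-> _] := E r Ur Sr.
  have [_ E2] := deriv1_agree oU (Cinfty_lagrangian CG oU Ch hI) K Up Sp.
  exact: E2.
exact: (congr2 (fun x y => x - y) E1 E2).
Qed.

End ChartRepresentation.

(** * The equation with lowered index and the Euler-Lagrange covector *)

Section LoweredEquation.
Context {R : realType} {n : nat}.

Lemma bilinE (A : 'M[R]_n) (u w : 'rV[R]_n) :
  bilin A u w = \sum_j w 0 j * (u *m A) 0 j.
Proof.
rewrite /bilin exchange_big; apply: eq_bigr => j _; rewrite mxE mulr_sumr.
by apply: eq_bigr => i _; ring.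
Qed.

(** [L] is the connection with its upper index lowered. Compatibility writes [D] as a sum of two
    values of [L], and torsion-freeness makes [L] symmetric in its first two indices. *)
Lemma christoffel_contraction (A : 'I_n -> 'I_n -> R)
    (Gamma D : 'I_n -> 'I_n -> 'I_n -> R) (v : 'I_n -> R) j :
  (forall i l, A i l = A l i) ->
  (forall k i l, Gamma k i l = Gamma k l i) ->
  (forall l i k, D l i k =
     \sum_m (Gamma m l i * A m k + Gamma m l k * A i m)) ->
  \sum_k (\sum_i \sum_l Gamma k i l * v i * v l) * A k j =
  \sum_i \sum_l (D l i j - 2^-1 * D j i l) * v l * v i.
Proof.
move=> As Gs HD; pose L i l k := \sum_m Gamma m i l * A m k.
have Ls i l k : L i l k = L l i k by apply: eq_bigr => m _; rewrite Gs.
have DL l i k : D l i k = L l i k + L l k i.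
  rewrite HD big_split /=; congr (_ + _); apply: eq_bigr => m _.
  by rewrite As.
have -> : \sum_k (\sum_i \sum_l Gamma k i l * v i * v l) * A k j =
    \sum_i \sum_l L l i j * v l * v i.
  under eq_bigr do rewrite mulr_suml.
  rewrite exchange_big; apply: eq_bigr => i _.
  under eq_bigr do rewrite mulr_suml.
  rewrite exchange_big; apply: eq_bigr => l _.
  rewrite Ls /L !mulr_suml; apply: eq_bigr => m _; ring.
(* [S] occurs once through [D l i j] and twice, with factor one half, through [D j i l]; these
   contributions cancel. *)
pose S := \sum_i \sum_l L j l i * v l * v i.
have S' : S = \sum_i \sum_l L j i l * v l * v i.
  rewrite /S exchange_big; apply: eq_bigr => i _; apply: eq_bigr => l _; ring.
transitivity (\sum_i \sum_l L l i j * v l * v i + S - 2^-1 * (S + S)); first by field.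
rewrite {2}S' /S -!big_split /= mulr_sumr -sumrB; apply: eq_bigr => i _.
rewrite -!big_split /= mulr_sumr -sumrB; apply: eq_bigr => l _.
by rewrite !DL (Ls l j i); ring.
Qed.

End LoweredEquation.

Section PathEquation.
Context {R : realType} {n : nat} {M : manifold R n}.
Variables (g : riemannian_metric M) (a b : R).
Hypotheses (ab : a < b).
Local Notation ds := ((1, 0) : R * R).
Local Notation dt := ((0, 1) : R * R).

Definition geodesic_vector (p : R -> M) (c : chart R n M) (t : R) : 'rV[R]_n :=
  covariant_derivative g a b p (velocity a b p) c t +
    sharp g c t (p t) (flat_dot g c t (p t) (velocity a b p c t)).

Lemma dgcompE c t x l i j :
  dgcomp g c t x l i j =
  'D_((0, delta_mx 0 l) : R * 'rV[R]_n) (fun p => metric_in g c p i j)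
    (t, chart_coord c x).
Proof.
apply: (@derive_affine R _ _ _ (fun p => metric_in g c p i j)
  (fun y : 'rV[R]_n => (t, y))).
by move=> s; congr pair; rewrite /= scaler0 add0r.
Qed.

Lemma gdotE c t x i j : atlas M c -> chart_dom c x ->
  gdot g c t x i j =
  'D_((1, 0) : R * 'rV[R]_n) (fun p => metric_in g c p i j) (t, chart_coord c x).
Proof.
move=> ac cx.
have Wt : metric_dom c (t, chart_coord c x) by split => //=; exists x.
have dG := Cinfty_differentiable (Cinfty_metric_in g ac) Wt.
have [_ ->] := derive_coord i j ((1, 0) : R * 'rV[R]_n) dG.
rewrite /gdot derive1E.
have [|_ <-] := @derive_line R _ _ (metric_in g c)
    (fun s => (s, chart_coord c x)) (1, 0) t.
  by move=> s; congr pair; rewrite /= ?scaler0 ?add0r // [_ *: _]mulr1.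
suff -> : (fun s => gcomp g c s x) =
  metric_in g c \o (fun s => (s, chart_coord c x)) by [].
apply/funext => s; by rewrite /metric_in /= chart_coordK.
Qed.

(** Lowering cancels [sharp], so that term becomes the time derivative of the metric applied to the
    velocity; the Christoffel terms become the quadratic terms of [euler_lagrange]. The parameter
    [s] is frozen, and [h] extends the coordinates of [p]. *)
Lemma geodesic_vector_lowered p c (U : set (R * R)) (h : R * R -> 'rV[R]_n) s t w :
  atlas M c -> open U -> Cinfty U h -> U (s, t) -> t \in `[a, b] ->
  (forall u, U (s, u) -> u \in `[a, b] -> chart_dom c (p u) /\
    h (s, u) = chart_coord c (p u)) ->
  bilin (gcomp g c t (p t)) (geodesic_vector p c t) w =
  \sum_j w 0 j * euler_lagrange (metric_in g c) h j (s, t).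
Proof.
move=> ac oU Ch Ust tab hE.
have [cp hst] := hE t Ust tab.
have vE u : U (s, u) -> u \in `[a, b] -> velocity a b p c u = 'D_dt h (s, u).
  move=> Usu uab; have [<- D] := derive_slice2 h (s, u).
  apply: (derive_withinE ab uab).
    apply: filterS (near_slice2 oU Usu) => r Ur rab.
    by have [_ /= ->] := hE r Ur rab.
  by apply: D; apply: diff_derivable; exact: Cinfty_differentiable Usu.
have aE : derive_within `[a, b] (velocity a b p c) t =
    'D_dt (fun q => 'D_dt h q) (s, t).
  have Cht := Cinfty_derive dt Ch.
  have [<- D] := derive_slice2 (fun q => 'D_dt h q) (s, t).
  apply: (derive_withinE ab tab).
    apply: filterS (near_slice2 oU Ust) => r Ur rab; exact: vE.
  by apply: D; apply: diff_derivable; exact: Cinfty_differentiable Cht Ust.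
set A := gcomp g c t (p t).
have As i l : A i l = A l i by exact: gcomp_sym.
have GA : metric_in g c (t, h (s, t)) = A by rewrite /metric_in /= hst chart_coordK.
(* The defining formula is traded for symmetry and metric compatibility. *)
have [Gs HD] := (christoffelP g t (christoffel g c t (p t)) ac cp).1
  (fun _ _ _ => erefl).
rewrite bilinE; apply: eq_bigr => j _; congr (_ * _).
rewrite /geodesic_vector mulmxDl mxE.
have -> : sharp g c t (p t) (flat_dot g c t (p t) (velocity a b p c t)) *m A =
    flat_dot g c t (p t) (velocity a b p c t) by exact: sharpK.
set v := velocity a b p c t.
have Ed i : gdot g c t (p t) i j = 'D_((1, 0) : R * 'rV[R]_n)
    (fun p => metric_in g c p i j) (t, h (s, t)).
  by rewrite hst; exact: gdotE.
have Ex l i k : dgcomp g c t (p t) l i k = 'D_((0, delta_mx 0 l) : R * 'rV[R]_n)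
    (fun p => metric_in g c p i k) (t, h (s, t)).
  by rewrite hst; exact: dgcompE.
have -> : (covariant_derivative g a b p (velocity a b p) c t *m A) 0 j =
    \sum_k 'D_dt (fun q => 'D_dt h q) (s, t) 0 k * A k j +
    \sum_i \sum_l (dgcomp g c t (p t) l i j - 2^-1 * dgcomp g c t (p t) j i l) *
      v 0 l * v 0 i.
  rewrite mxE -(christoffel_contraction (A := A) _ _ As Gs HD).
  rewrite -big_split; apply: eq_bigr => k _ /=.
  by rewrite mxE aE mulrDl.
rewrite [flat_dot _ _ _ _ _ _ _]mxE /euler_lagrange /= GA.
rewrite -!big_split /=; apply: eq_bigr => i _.
rewrite [LHS]addrC [LHS]addrA /v (vE _ Ust tab) Ed.
congr (_ + _ + _); [exact: mulrC|exact: mulrC|].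
by apply: eq_bigr => l _; rewrite !Ex.
Qed.

End PathEquation.

(** * First variation formula for the energy *)

Section FirstVariation.
Context {R : realType} {n : nat} {M : manifold R n}.
Variables (g : riemannian_metric M) (a b : R).
Hypotheses (ab : a < b).
Local Notation mu := (@lebesgue_measure R).

Definition first_variation_density (H : R * R -> M) (t : R) : R :=
  deriv2 a b (pairing g a b H) (0, t) - deriv1 (kinetic g a b H) (0, t).

Variables (p : R -> M) (e : R) (H : R * R -> M).
Hypotheses (e0 : 0 < e) (Hp : Defs.variation a b p e H).

Lemma svel0 c t : (\forall s \near (0 : R), H (s, t) = H (0, t)) ->
  svel H c (0, t) = 0.
Proof.
move=> Hc; rewrite /svel /=; transitivity ('D_1 (cst (chart_coord c (H (0, t)))) (0 : R)).
  by apply: near_eq_derive; apply: filterS Hc => s ->.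
exact: derive_cst.
Qed.

Lemma pairing_boundary t : t = a \/ t = b -> pairing g a b H (0, t) = 0.
Proof.
case: Hp => _ _ Ha Hb tE.
have I0 : (0 : R) \in `]- e, e[ by rewrite in_itv /= oppr_lt0 e0.
rewrite /pairing svel0 ?bilinE; first by apply: big1 => j _; rewrite mxE mul0r.
have : \forall s \near (0 : R), s \in `]- e, e[ by exact: near_in_itvoo.
by apply: filterS => s sI; case: tE => ->; rewrite ?Ha ?Hb.
Qed.

Lemma energy_first_variation :
  is_derive (0 : R) (1 : R) (fun s => energy g a b (fun t => H (s, t)))
    (- \int[mu]_(t in `[a, b]) first_variation_density H t).
Proof.
have [sH _ _ _] := Hp.
exact: (derive_integral_eq ab e0 (smooth_kinetic g ab sH)
  (smooth_pairing g ab sH) (pairing_boundary (or_introl erefl))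
  (pairing_boundary (or_intror erefl))).
Qed.

Lemma first_variation_density_continuous :
  {within `[a, b], continuous (first_variation_density H)}.
Proof.
have [sH _ _ _] := Hp.
have I0 : (0 : R) \in `]- e, e[ by rewrite in_itv /= oppr_lt0 e0.
have c1 := slice_continuous I0 (smooth_on_continuous
  (smooth_on_deriv2 ab (smooth_pairing g ab sH))).
have c2 := slice_continuous I0 (smooth_on_continuous
  (smooth_on_deriv1 (smooth_kinetic g ab sH))).
apply/subspace_continuousP => t tab.
have /subspace_continuousP/(_ t tab) d1 := c1.
have /subspace_continuousP/(_ t tab) d2 := c2.
exact: cvgB d1 d2.
Qed.

(** The left side does not mention [c], so the chart may be chosen separately at each time. *)
Lemma first_variation_densityE c t : atlas M c -> t \in `[a, b] ->
  chart_dom c (p t) ->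
  first_variation_density H t =
    bilin (gcomp g c t (p t)) (geodesic_vector g a b p c t) (svel H c (0, t)).
Proof.
move=> ac tab ct; have [sH H0 _ _] := Hp.
have St := strip0 e0 tab.
have [U [h [[oU Ut Ch hE] hI vE dE]]] :=
  deriv_pairing_kinetic g ab sH ac St (eq_ind_r (chart_dom c) ct (H0 t tab)).
rewrite /first_variation_density dE //; apply/esym.
apply: (geodesic_vector_lowered g ab _ ac oU Ch Ut tab) => u Uu uab.
by have := hE _ Uu (strip0 e0 uab); rewrite H0.
Qed.

End FirstVariation.

(** * Bump functions and variations supported in a chart *)

Section FlatFunction.
Context {R : realType}.

(* [flat_exp k] is x^-k exp(-1/x) for x > 0, extended by 0; this family is
   closed under linear combinations of derivatives. *)
Definition flat_exp (k : nat) (x : R) : R :=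
  if 0 < x then x^-1 ^+ k * expR (- x^-1) else 0.

Lemma flat_exp_ge0 k x : 0 <= flat_exp k x.
Proof.
rewrite /flat_exp; case: ifP => // x0.
by rewrite mulr_ge0 ?expR_ge0 // exprn_ge0 // invr_ge0 ltW.
Qed.

Lemma flat_exp_gt0 k x : 0 < x -> 0 < flat_exp k x.
Proof.
by move=> x0; rewrite /flat_exp x0 mulr_gt0 ?expR_gt0 // exprn_gt0 // invr_gt0.
Qed.

Lemma flat_exp_le1 x : flat_exp 0 x <= 1.
Proof.
rewrite /flat_exp; case: ifP => // x0.
by rewrite expr0 mul1r expR_le1 oppr_le0 invr_ge0 ltW.
Qed.

Lemma flat_exp_npos k x : x <= 0 -> flat_exp k x = 0.
Proof. by rewrite /flat_exp ltNge => ->. Qed.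

(** With y = 1/x, the exponential series gives y^(k+2) <= (k+2)! exp y. A bound quadratic in [x] is
    what makes the derivative at 0 vanish. *)
Lemma flat_exp_bound k x : `|flat_exp k x| <= (k.+2)`!%:R * x ^+ 2.
Proof.
rewrite ger0_norm ?flat_exp_ge0 // /flat_exp; case: ifP => [x0|_]; last first.
  by rewrite mulr_ge0 ?ler0n ?sqr_ge0.
set y := x^-1; have y0 : 0 < y by rewrite invr_gt0.
have f0 : 0 < (k.+2)`!%:R :> R by rewrite ltr0n fact_gt0.
have E : y ^+ k.+2 <= (k.+2)`!%:R * expR y.
  rewrite mulrC -ler_pdivrMr //; apply: le_trans (expR_ge1Dxn k.+1 (ltW y0)).
  by rewrite lerDr.
rewrite expRN ler_pdivrMr ?expR_gt0 // mulrAC.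
have -> : x ^+ 2 = (y ^+ 2)^-1 by rewrite -exprVn invrK.
by rewrite ler_pdivlMr ?exprn_gt0 // -exprD addn2.
Qed.

Lemma is_derive_flat_exp k (x : R) :
  is_derive x (1 : R) (flat_exp k) (flat_exp k.+2 x - k%:R * flat_exp k.+1 x).
Proof.
have [x0|x0|->] := ltgtP x 0.
- rewrite !flat_exp_npos ?ltW // mulr0 subr0.
  apply: (@near_eq_is_derive R R R (cst 0) _ x 1 0).
  have : \forall y \near x, y < 0 by exact: lt_nbhsl.
  by apply: filterS => y y0; rewrite flat_exp_npos // ltW.
- have xn0 : x != 0 by rewrite gt_eqF.
  have D1 : is_derive x (1 : R) (fun y : R => y^-1) (- x ^- 2).
    have := is_deriveV xn0 (is_derive_id x (1 : R)).
    by rewrite [_ *: 1]mulr1.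
  have D2 : is_derive x (1 : R) (fun y : R => expR (- y^-1))
      (expR (- x^-1) * - - x ^- 2).
    have D1N : is_derive x (1 : R) (fun y : R => - y^-1) (- - x ^- 2).
      exact: (is_deriveN D1).
    exact: (@is_derive1_comp R expR (fun y => - y^-1) x _ _ (is_derive_expR _) D1N).
  have DX : is_derive x (1 : R) (fun y : R => y^-1 ^+ k)
      (k%:R * x^-1 ^+ k.-1 * - x ^- 2).
    have -> : (fun y : R => y^-1 ^+ k) = (fun y : R => y^-1) ^+ k.
      by apply/funext => y; elim: k => [|k IH] //; rewrite !exprS IH.
    exact: (is_deriveX k D1).
  have D3 := is_derive_mulf DX D2.
  have E : \forall y \near x, y^-1 ^+ k * expR (- y^-1) = flat_exp k y.
    have : \forall y \near x, 0 < y by exact: lt_nbhsr.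
    by apply: filterS => y y0; rewrite /flat_exp y0.
  have D4 := near_eq_is_derive E D3; apply: (is_derive_eq D4).
  rewrite /flat_exp x0 -exprVn; set y := x^-1; set z := expR _.
  (* The exponent [k.-1] truncates at 0, where the factor [k%:R] removes the term. *)
  case: k {DX D3 D4 E} => [|k] /=; first by rewrite mulr0n !mul0r; ring.
  by rewrite !exprS expr0; ring.
rewrite !flat_exp_npos // mulr0 subr0.
(* At 0 the difference quotient is at most (k+2)! times the absolute value of [h]. *)
suff C : h^-1 *: ((flat_exp k \o shift 0) (h *: 1) - flat_exp k 0)
    @[h --> 0^'] --> (0 : R).
  by split; [apply/cvg_ex; exists 0; exact: C|exact/cvg_lim/C].
apply/cvgrPdist_le => e e0.
pose C := (k.+2)`!%:R : R.
have C0 : 0 < C by rewrite ltr0n fact_gt0.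
have : \forall h \near (0 : R)^', `|h| <= e / C.
  by apply: dnbhs0_le; rewrite divr_gt0.
have : \forall h \near (0 : R)^', h != 0 by exact: nbhs_dnbhs_neq.
apply: filterS2 => h hn0 he.
rewrite /= (flat_exp_npos k (lexx 0)) subr0 addr0 [_ *: 1]mulr1 sub0r normrN normrM.
rewrite normfV ler_pdivrMl ?normr_gt0 //.
apply: le_trans (flat_exp_bound k h) _.
rewrite -real_normK ?num_real // expr2 mulrCA mulrC.
by rewrite [leRHS]mulrC ler_wpM2r // -ler_pdivlMl // mulrC.
Qed.

Lemma Cinfty_flat_exp k : Cinfty [set: R] (flat_exp k).
Proof.
move=> m; elim: m k => [|m IH] k.
  move=> x _; apply: differentiable_continuous; apply/derivable1_diffP.
  by have [] := is_derive_flat_exp k x.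
apply/CkSP; split=> [x _|v].
  by apply/derivable1_diffP; have [] := is_derive_flat_exp k x.
apply: (@Ck_eq _ _ _ _ _ (fun x => v * (flat_exp k.+2 x + (- k%:R) * flat_exp k.+1 x))).
- exact: openT.
- move=> x _; have [D E] := is_derive_flat_exp k x.
  have df : differentiable (flat_exp k) x by apply/derivable1_diffP.
  rewrite (deriveE v df) -[v in RHS]mulr1 -[v * 1]/(v *: (1 : R)) linearZ.
  by rewrite -(deriveE (1 : R) df) E mulNr.
apply: CkM; [exact: openT|exact: Ck_cst|].
apply: CkD; [exact: openT|exact: IH|].
by apply: CkM; [exact: openT|exact: Ck_cst|exact: IH].
Qed.

(** Positive exactly on the open interval of radius [d] around [t0], with values at most 1. *)
Definition bump_fun (t0 d t : R) : R :=
  flat_exp 0 (t - (t0 - d)) * flat_exp 0 (t0 + d - t).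

Lemma bump_fun_ge0 t0 d t : 0 <= bump_fun t0 d t.
Proof. by rewrite mulr_ge0 ?flat_exp_ge0. Qed.

Lemma bump_fun_le1 t0 d t : bump_fun t0 d t <= 1.
Proof. by rewrite -[1]mulr1 ler_pM ?flat_exp_ge0 ?flat_exp_le1. Qed.

Lemma bump_fun_gt0 t0 d : 0 < d -> 0 < bump_fun t0 d t0.
Proof. by move=> d0; rewrite mulr_gt0 // flat_exp_gt0 //; lra. Qed.

Lemma bump_fun_eq0 t0 d t : d <= `|t - t0| -> bump_fun t0 d t = 0.
Proof.
rewrite /bump_fun ler_normr => /orP[td|td].
  by rewrite [flat_exp 0 (t0 + _ - _)]flat_exp_npos ?mulr0 //; lra.
by rewrite flat_exp_npos ?mul0r //; lra.
Qed.

Lemma Cinfty_bump_fun t0 d : Cinfty [set: R] (bump_fun t0 d).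
Proof.
move=> k; apply: CkM; first exact: openT.
  apply: (Ck_comp (U' := [set: R]) has_frame_real openT
    (f := fun t => t - (t0 - d))) => //; last exact: Cinfty_flat_exp.
  by apply: CkD; [exact: openT|exact: Ck_id|exact: Ck_cst].
apply: (Ck_comp (U' := [set: R]) has_frame_real openT
  (f := fun t => t0 + d - t)) => //; last exact: Cinfty_flat_exp.
apply: CkD; [exact: openT|exact: Ck_cst|].
rewrite (_ : -%R = fun t : R => (-1) * t); last first.
  by apply/funext => x; rewrite mulN1r.
by apply: CkM; [exact: openT|exact: Ck_cst|exact: Ck_id].
Qed.

End FlatFunction.

Section Variations.
Context {R : realType} {n : nat} {M : manifold R n}.
Variables (a b : R) (p : R -> M).
Hypothesis sp : smooth_map (`[a, b] : set R) p.
Local Notation strip e := ((`]- e, e[ : set R) `*` (`[a, b] : set R)).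

Lemma overlap_nbhs (c d : chart R n M) x : chart_dom c x -> chart_dom d x ->
  nbhs (chart_coord c x) (chart_coord c @` (chart_dom c `&` chart_dom d)).
Proof.
move=> cx dx; have ix : (chart_coord c @` chart_dom c) (chart_coord c x) by exists x.
have n1 : nbhs (chart_coord c x) (chart_coord c @` chart_dom c).
  by apply: open_nbhs_nbhs; split => //; exact: chart_image_open.
have n2 : nbhs (chart_coord c x) (chart_point c @^-1` chart_dom d).
  apply: (chart_point_continuous ix); rewrite chart_coordK //.
  by apply: open_nbhs_nbhs; split => //; exact: chart_open.
apply: filterS (filterI n1 n2) => _ [[y cy <-]]; rewrite /= chart_coordK // => dy.
by exists y.
Qed.

Lemma open_snd_preimage (U : set R) : open U -> open ((@snd R R) @^-1` U).
Proof. by move=> oU; apply: open_comp => // q _; exact: cvg_snd. Qed.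

Lemma path_snd_cvg e q : strip e q ->
  (p \o snd) @ within (strip e) (nbhs q) --> p q.2.
Proof.
move=> [q1 q2] P HP; have [/subspace_continuousP cp _] := sp.
have H1 : nbhs q.2 [set r | r \in `[a, b] -> P (p r)] := cp _ q2 _ HP.
have H2 : (@snd R R) r @[r --> q] --> q.2 by exact: cvg_snd.
have H3 : nbhs q [set r | strip e r -> P (p r.2)].
  have H4 : nbhs q [set r | r.2 \in `[a, b] -> P (p r.2)] := H2 _ H1.
  by apply: filterS H4 => r /= Hr [_ /= rab]; exact: Hr.
exact: H3.
Qed.

Lemma path_snd_smooth e q (d : chart R n M) : atlas M d -> strip e q ->
  chart_dom d (p q.2) -> exists (U : set R) (h : R -> 'rV[R]_n),
  [/\ open U, U q.2, Cinfty U h,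
      Cinfty ((@snd R R) @^-1` U) (h \o snd) &
      forall t, U t -> t \in `[a, b] -> chart_dom d (p t) ->
        h t = chart_coord d (p t)].
Proof.
move=> ad [_ q2] dq; have [_ /(_ d ad q.2)] := sp.
case=> [|U [h [oU Uq Ch hE]]]; first by split.
exists U, h; split => // [k|t Ut tab dt]; last by apply: hE.
apply: (Ck_comp (U' := U) has_frame_real (open_snd_preimage oU)) => //.
exact: (Ck_clinear (L := snd) (f := id) (open_snd_preimage oU)
  (@clinear_snd R R R) (Ck_id _ _)).
Qed.

(** Lets results on variations, such as the existence of an extension [h], be applied to the path
    itself. *)
Lemma constant_variation e : Defs.variation a b p e (p \o snd).
Proof.
split => //; split.
  apply/subspace_continuousP => q Sq; exact: path_snd_cvg.
move=> d ad q [Sq dq].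
have [U [h [oU Uq _ Ch hE]]] := path_snd_smooth ad Sq dq.
exists (snd @^-1` U), (h \o snd); split => //; first exact: open_snd_preimage.
by move=> y Uy [[_ yab] dy]; exact: hE.
Qed.

Variables (c : chart R n M) (t1 d e : R) (v : 'rV[R]_n).
Hypotheses (ac : atlas M c) (d0 : 0 < d) (e0 : 0 < e).
Hypothesis tube : forall t, `|t - t1| < 2 * d ->
  (t \in `]a, b[) /\ chart_dom c (p t).
Hypothesis tube_image : forall t x, `|t - t1| < 2 * d -> `|x| < e ->
  (chart_coord c @` chart_dom c) (chart_coord c (p t) + x *: v).

Definition perturbation (q : R * R) : 'rV[R]_n :=
  chart_coord c (p q.2) + (q.1 * bump_fun t1 d q.2) *: v.

(** The bump has radius [d] and the tube radius [2 * d]: at distances from [d] up to [2 * d] both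
    branches give [p], so the piecewise definition is smooth across the rim. *)
Definition bump_variation (q : R * R) : M :=
  if `|q.2 - t1| < 2 * d then chart_point c (perturbation q) else p q.2.

Local Notation H := bump_variation.

Lemma bump_variation_near s t : `|s| < e -> `|t - t1| < 2 * d ->
  chart_dom c (H (s, t)) /\ chart_coord c (H (s, t)) = perturbation (s, t).
Proof.
move=> se td; rewrite /H /= td.
have sb : `|s * bump_fun t1 d t| < e.
  rewrite normrM (ger0_norm (bump_fun_ge0 _ _ _)); apply: le_lt_trans se.
  by rewrite ler_piMr // bump_fun_le1.
have [x cx Ex] := tube_image td sb.
by rewrite /perturbation /= -Ex chart_coordK.
Qed.

(** Serves both for s = 0 and for times outside the support of the bump. *)
Lemma bump_variation_id s t : s * bump_fun t1 d t = 0 -> H (s, t) = p t.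
Proof.
rewrite /H /=; case: ifP => // td E; have [_ ct] := tube td.
by rewrite /perturbation /= E scale0r addr0 chart_coordK.
Qed.

Lemma bump_variation_far s t : d <= `|t - t1| -> H (s, t) = p t.
Proof. by move=> td; rewrite bump_variation_id // bump_fun_eq0 // mulr0. Qed.

Lemma snd_dist_cvg (q : R * R) : `|r.2 - t1| @[r --> q] --> `|q.2 - t1|.
Proof. by apply: cvg_norm; apply: cvgB; [exact: cvg_snd|exact: cvg_cst]. Qed.

Lemma near_tube (q : R * R) : `|q.2 - t1| < 2 * d ->
  \forall r \near q, `|r.2 - t1| < 2 * d.
Proof. by move=> qd; exact: (snd_dist_cvg (lt_nbhsl qd)). Qed.

Lemma near_far (q : R * R) : 2 * d <= `|q.2 - t1| ->
  \forall r \near q, d < `|r.2 - t1|.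
Proof.
move=> qd; have qd' : d < `|q.2 - t1|; last exact: (snd_dist_cvg (lt_nbhsr qd')).
by apply: lt_le_trans qd; rewrite ltr_pMl // ltr1n.
Qed.

Lemma strip_norm q : strip e q -> `|q.1| < e.
Proof. by move=> [/= q1 _]; rewrite ltr_norml; move: q1; rewrite in_itv. Qed.

Lemma perturbation_continuous (q : R * R) : `|q.2 - t1| < 2 * d ->
  {for q, continuous perturbation}.
Proof.
move=> qd; have [qab cq] := tube qd.
have cp : p t @[t --> q.2] --> p q.2.
  have [/subspace_continuousP cp _] := sp.
  have qab' : `[a, b]%classic q.2 by exact: subset_itv_oo_cc.
  move=> P HP.
  have H1 : nbhs q.2 [set r | r \in `[a, b] -> P (p r)] := cp _ qab' _ HP.
  have H2 : \forall t \near q.2, t \in `]a, b[ by exact: near_in_itvoo.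
  apply: filterS (filterI H1 H2) => t [Ht tab]; apply: Ht.
  exact: subset_itv_oo_cc.
have c1 : (chart_coord c \o p) t @[t --> q.2] --> chart_coord c (p q.2).
  apply: continuous_comp; first exact: cp.
  exact: chart_coord_continuous.
have H2 : (@snd R R) r @[r --> q] --> q.2 by exact: cvg_snd.
apply: cvgD.
  have c2 : ((chart_coord c \o p) \o snd) r @[r --> q] --> chart_coord c (p q.2).
    exact: cvg_comp H2 c1.
  exact: c2.
apply: cvgZr_tmp; apply: cvgM; first exact: cvg_fst.
have c3 : (bump_fun t1 d \o snd) r @[r --> q] --> bump_fun t1 d q.2.
  exact: cvg_comp H2 (Cinfty_continuous (Cinfty_bump_fun t1 d) I).
exact: c3.
Qed.

(** Inside the tube the chart formula holds nearby; elsewhere nearby times keep distance more than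
    [d] from [t1], and the map is [p \o snd] there. *)
Lemma bump_variation_smooth : smooth_map (strip e) H.
Proof.
split.
  apply/subspace_continuousP => q Sq.
  suff CH : H @ within (strip e) (nbhs q) --> H q by exact: CH.
  have [qd|qd] := ltP `|q.2 - t1| (2 * d).
    have [cH EH] : chart_dom c (H q) /\ chart_coord c (H q) = perturbation q.
      case: q Sq qd => s t Sq qd.
      by apply: bump_variation_near => //; exact: (strip_norm Sq).
    have Hq : H q = chart_point c (perturbation q) by rewrite -EH chart_coordK.
    apply: cvg_within_filter; rewrite Hq.
    have C : (chart_point c \o perturbation) r @[r --> q] -->
        chart_point c (perturbation q).
      apply: continuous_comp; first exact: perturbation_continuous.
      by apply: chart_point_continuous; rewrite -EH; exists (H q).
    apply: cvg_trans C; apply: near_eq_cvg.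
    by apply: filterS (near_tube qd) => r rd; rewrite /H rd.
  have -> : H q = p q.2 by rewrite /H ltNge qd.
  apply: cvg_trans (path_snd_cvg Sq); apply: near_eq_cvg.
  rewrite near_withinE; apply: filterS (near_far qd) => -[s t] /= rd _.
  by rewrite bump_variation_far // ltW.
move=> k ak q [Sq kq].
have [qd|qd] := ltP `|q.2 - t1| (2 * d); last first.
  have Hq : H q = p q.2 by rewrite /H ltNge qd.
  have kq' : chart_dom k (p q.2) by rewrite -Hq.
  have [U [h [oU Uq _ Ch hE]]] := path_snd_smooth ak Sq kq'.
  have [N [oN Nq Nd]] := open_sub_nbhs (near_far qd).
  exists ((snd @^-1` U) `&` N), (h \o snd); split.
  - by apply: openI => //; exact: open_snd_preimage.
  - by [].
  - by move=> m; apply: Ck_sub (Ch m) => r [].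
  - move=> [s t] [/= Ut Nt] [[_ /= tab] /=].
    by rewrite bump_variation_far ?(ltW (Nd _ Nt)) //; exact: hE.
have [cH EH] : chart_dom c (H q) /\ chart_coord c (H q) = perturbation q.
  case: q Sq qd kq => s t Sq qd _.
  by apply: bump_variation_near => //; exact: (strip_norm Sq).
have [qab cq] := tube qd.
have [U [h [oU Uq Ch Chs hE]]] := path_snd_smooth ac Sq cq.
(* [perturbation] with the coordinates of [p] replaced by a smooth extension; another chart [k] is
   then reached through the transition map. *)
pose K r := h r.2 + (r.1 * bump_fun t1 d r.2) *: v.
have KE r : U r.2 -> `|r.2 - t1| < 2 * d -> K r = perturbation r.
  move=> Ur rd; have [rab cr] := tube rd.
  by rewrite /K /perturbation hE //; exact: subset_itv_oo_cc.
have oU' := open_snd_preimage oU.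
have CK : Cinfty ((@snd R R) @^-1` U) K.
  move=> m; apply: CkD; [exact: oU'|exact: Chs|].
  apply: CkZ; [exact: oU'| |exact: Ck_cst].
  apply: CkM; first exact: oU'.
    exact: (Ck_clinear (L := fst) (f := id) oU' (@clinear_fst R R R) (Ck_id _ _)).
  apply: (Ck_comp (U' := [set: R]) (f := snd) (g := bump_fun t1 d)
    has_frame_real oU') => //.
    exact: (Ck_clinear (L := snd) (f := id) oU' (@clinear_snd R R R) (Ck_id _ _)).
  exact: Cinfty_bump_fun.
pose T := chart_coord c @` (chart_dom c `&` chart_dom k).
have nT : nbhs q (K @^-1` T).
  apply: (Cinfty_continuous CK Uq); rewrite KE // -EH; exact: overlap_nbhs.
have [N [oN Nq NT]] := open_sub_nbhs (filterI (near_tube qd) nT).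
exists ((snd @^-1` U) `&` N), (transition c k \o K); split.
- exact: openI.
- by [].
- move=> m; apply: (Ck_comp (U' := T) (has_frame_rV n) (openI oU' oN)).
  + by move=> r [_ /NT[]].
  + by apply: Ck_sub (CK m) => r [].
  + exact: (atlas_smooth ac ak m).
- move=> r [Ur /NT[/= rd _]] _.
  by rewrite /= KE // /H rd.
Qed.

Lemma bump_variationP : Defs.variation a b p e H.
Proof.
(* The tube lies over the open interval, so it excludes both endpoints. *)
have far t : (t = a \/ t = b) -> 2 * d <= `|t - t1|.
  move=> tE; rewrite leNgt; apply/negP => /tube[].
  by rewrite in_itv /= => /andP[]; case: tE => ->; rewrite ltxx.
have d2 : d <= 2 * d by rewrite ler_pMl // ler1n.
split; first exact: bump_variation_smooth.
- by move=> t _; rewrite bump_variation_id // mul0r.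
- by move=> s _; rewrite bump_variation_far // (le_trans d2) //; apply: far; left.
- by move=> s _; rewrite bump_variation_far // (le_trans d2) //; apply: far; right.
Qed.

Lemma svel_bump_variation_near t : `|t - t1| < 2 * d ->
  svel H c (0, t) = bump_fun t1 d t *: v.
Proof.
move=> td; rewrite /svel /=.
have E : \forall s \near (0 : R), chart_coord c (p t) + s *: (bump_fun t1 d t *: v) =
    chart_coord c (H (s, t)).
  have : \forall s \near (0 : R), s \in `]- e, e[.
    by apply: near_in_itvoo; rewrite in_itv /= oppr_lt0 e0.
  apply: filterS => s; rewrite in_itv /= -ltr_norml => se.
  by have [_ ->] := bump_variation_near se td; rewrite scalerA.
rewrite -(near_eq_derive _ E).
set w := bump_fun t1 d t *: v.
have [ds1 ds2] := is_diff_scalel (0 : R) w.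
rewrite (_ : (fun s : R => _) = cst (chart_coord c (p t)) + ( *:%R ^~ w)); last by [].
rewrite deriveD //; last exact: diff_derivable.
by rewrite derive_cst add0r deriveE // ds2 scale1r.
Qed.

Lemma svel_bump_variation_far t c' : 2 * d <= `|t - t1| -> svel H c' (0, t) = 0.
Proof.
move=> td; have d2 : d <= 2 * d by rewrite ler_pMl // ler1n.
by apply: svel0; near=> s; rewrite !bump_variation_far // (le_trans d2).
Unshelve. all: by end_near. Qed.

End Variations.

(** * Equivalence of criticality and the equation *)

Section Criticality.
Context {R : realType} {n : nat} {M : manifold R n}.
Variables (g : riemannian_metric M) (a b : R) (p : R -> M).
Hypotheses (ab : a < b) (sp : smooth_map (`[a, b] : set R) p).
Local Notation mu := (@lebesgue_measure R).

Lemma first_variation_density_fixed e (H : R * R -> M) t : 0 < e ->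
  Defs.variation a b p e H -> t \in `[a, b] ->
  svel H (chart_at (p t)) (0, t) = 0 -> first_variation_density g a b H t = 0.
Proof.
move=> e0 Hp tab sv; have [ac cp] := chart_atP (p t).
rewrite (first_variation_densityE g ab e0 Hp ac tab cp) sv bilinE.
by apply: big1 => j _; rewrite mxE mul0r.
Qed.

Lemma geodesic_critical :
  (forall t, t \in `[a, b] -> forall c, atlas M c -> chart_dom c (p t) ->
    geodesic_vector g a b p c t = 0) -> critical g a b p.
Proof.
move=> Hg e H e0 Hp; have [D E] := energy_first_variation g ab e0 Hp.
split; first exact: D.
rewrite E; suff -> : \int[mu]_(t in `[a, b]) first_variation_density g a b H t = 0.
  by rewrite oppr0.
transitivity (\int[mu]_(t in `[a, b]) (0 : R)); last first.
  by rewrite Rintegral_cst ?mul0r //; exact: measurable_itv.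
apply: eq_Rintegral => t /set_mem tab; have [ac cp] := chart_atP (p t).
rewrite (first_variation_densityE g ab e0 Hp ac tab cp) Hg // bilinE.
by apply: big1 => j _; rewrite mul0mx mxE mulr0.
Qed.

(** With the components [v] held constant, the pairing is locally a continuous function of time,
    given by [euler_lagrange] along the constant variation. *)
Lemma geodesic_pairing_near c t0 v : atlas M c -> t0 \in `[a, b] ->
  chart_dom c (p t0) ->
  0 < bilin (gcomp g c t0 (p t0)) (geodesic_vector g a b p c t0) v ->
  \forall t \near t0, t \in `[a, b] -> chart_dom c (p t) /\
    0 < bilin (gcomp g c t (p t)) (geodesic_vector g a b p c t) v.
Proof.
move=> ac tab ct pos; have [sH H0 _ _] := constant_variation sp 1.
have St : ((`](- 1), 1[ : set R) `*` (`[a, b] : set R)) (0, t0).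
  exact: strip0.
have [U [h [[oU Ut Ch hE] hI _ _]]] := deriv_pairing_kinetic g ab sH ac St ct.
have hE' u : U (0, u) -> u \in `[a, b] -> chart_dom c (p u) /\
    h (0, u) = chart_coord c (p u).
  by move=> Uu uab; exact: (hE _ Uu (strip0 ltr01 uab)).
pose F q := \sum_j v 0 j * euler_lagrange (metric_in g c) h j q.
have FE u : U (0, u) -> u \in `[a, b] ->
    bilin (gcomp g c u (p u)) (geodesic_vector g a b p c u) v = F (0, u).
  by move=> Uu uab; exact: (geodesic_vector_lowered g ab v ac oU Ch Uu uab hE').
have CF : Cinfty U F.
  move=> k; apply: Ck_sum => // j _; apply: CkM => //; first exact: Ck_cst.
  have CE := Cinfty_euler_lagrange (open_metric_dom (c := c))
    (Cinfty_metric_in g ac) oU Ch hI.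
  exact: CE.
have N1 : nbhs t0 [set u | 0 < F (0, u)].
  rewrite FE // in pos.
  have [V [oV Vq VF]] := open_sub_nbhs (Cinfty_continuous CF Ut (lt_nbhsr pos)).
  by apply: filterS (near_slice2 oV Vq) => u /VF.
have N2 : nbhs t0 [set u | U (0, u)] by exact: (near_slice2 oU Ut).
apply: filterS (filterI N1 N2) => u [Fu Uu] uab; split; last by rewrite FE.
by have [] := hE' u Uu uab.
Qed.

(** Needed when [t0] is an endpoint. Half the radius keeps the new time in the neighbourhood, and
    the midpoint keeps it strictly inside the interval. *)
Lemma exists_interior_near t0 (N : set R) : t0 \in `[a, b] -> nbhs t0 N ->
  exists2 t1, t1 \in `]a, b[ & nbhs t1 N.
Proof.
rewrite in_itv /= => /andP[at0 t0b] /open_sub_nbhs[U [oU Ut UN]].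
have [r /= r0 Hr] := (nbhs_ballP _ _).1 (open_nbhs_nbhs (conj oU Ut)).
suff [t1 t1ab t1r] : exists2 t1, t1 \in `]a, b[ & `|t0 - t1| < r.
  exists t1 => //; apply: (filterS UN); apply: open_nbhs_nbhs; split => //.
  exact: Hr.
have [tb|bt] := ltP t0 b.
  pose m := Num.min (t0 + r / 2) ((t0 + b) / 2).
  have m1 : m <= t0 + r / 2 by rewrite ge_min lexx.
  have m2 : m <= (t0 + b) / 2 by rewrite ge_min lexx orbT.
  have m3 : t0 < m by rewrite lt_min; apply/andP; split; lra.
  exists m; first by rewrite in_itv /=; apply/andP; split; lra.
  by rewrite ltr0_norm; lra.
pose m := Num.max (t0 - r / 2) ((a + b) / 2).
have m1 : t0 - r / 2 <= m by rewrite le_max lexx.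
have m2 : (a + b) / 2 <= m by rewrite le_max lexx orbT.
have m3 : m < t0.
  by rewrite gt_max ltrBlDr ltrDl divr_gt0 //= (lt_le_trans _ bt) // midf_lt.
exists m; last by rewrite gtr0_norm; lra.
by rewrite in_itv /= (lt_le_trans _ m2) ?midf_lt //= (lt_le_trans m3).
Qed.

Lemma exists_tube (c : chart R n M) t1 (v : 'rV[R]_n) (N : set R) :
  t1 \in `]a, b[ -> chart_dom c (p t1) -> nbhs t1 N -> exists d e : R, [/\ 0 < d, 0 < e,
    forall t, `|t - t1| < 2 * d -> [/\ t \in `]a, b[, chart_dom c (p t) & N t] &
    forall t x, `|t - t1| < 2 * d -> `|x| < e ->
      (chart_coord c @` chart_dom c) (chart_coord c (p t) + x *: v)].
Proof.
move=> t1ab ct nN; have t1ab' : t1 \in `[a, b] by exact: subset_itv_oo_cc.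
have it : (chart_coord c @` chart_dom c) (chart_coord c (p t1)) by exists (p t1).
have : nbhs (chart_coord c (p t1)) (chart_coord c @` chart_dom c).
  by apply: open_nbhs_nbhs; split => //; exact: chart_image_open.
move=> /nbhs_ballP[r /= r0 Hr].
have r2 : 0 < r / 2 by rewrite divr_gt0.
have nO : nbhs (p t1) [set x | chart_dom c x /\
    ball (chart_coord c (p t1)) (r / 2) (chart_coord c x)].
  have n1 : nbhs (p t1) (chart_dom c).
    by apply: open_nbhs_nbhs; split => //; exact: chart_open.
  have n2 := chart_coord_continuous ct (nbhsx_ballx _ _ r2).
  exact: filterI n1 n2.
have [/subspace_continuousP cp _] := sp.
have H1 : nbhs t1 [set t | t \in `[a, b] -> chart_dom c (p t) /\
    ball (chart_coord c (p t1)) (r / 2) (chart_coord c (p t))] := cp _ t1ab' _ nO.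
have H2 : \forall t \near t1, t \in `]a, b[ by exact: near_in_itvoo.
have [d /= d0 Hd] := (nbhs_ballP _ _).1 (filterI (filterI H1 H2) nN).
have Hd' t : `|t - t1| < 2 * (d / 2) -> [/\ t \in `]a, b[, chart_dom c (p t), N t &
    ball (chart_coord c (p t1)) (r / 2) (chart_coord c (p t))].
  rewrite mulrC divfK // => td.
  have [|[Ht tab] Nt] := Hd t; first by rewrite /ball /= distrC.
  by have [] := Ht (subset_itv_oo_cc tab).
have v1 : 0 < `|v| + 1 by rewrite ltr_pwDr.
(* [d] is halved because the tube has radius twice the witness. The coordinates of the path use up
   half of [r] and the displacement along [v] the other half; adding 1 keeps the divisor positive
   when [v] is 0. *)
exists (d / 2), (r / 2 / (`|v| + 1)); split.
- by rewrite divr_gt0.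
- by rewrite divr_gt0.
- by move=> t /Hd'[].
move=> t x /Hd'[_ _ _ tr] xe; apply: Hr; move: tr; rewrite -!ball_normE /= => tr.
rewrite opprD addrA (splitr r); apply: le_lt_trans (ler_normB _ _) _.
rewrite ltrD // normrZ; apply: (@le_lt_trans _ _ (`|x| * (`|v| + 1))).
  by rewrite ler_wpM2l // lerDl.
by rewrite -ltr_pdivlMr.
Qed.

Lemma critical_geodesic : critical g a b p ->
  forall t, t \in `[a, b] -> forall c, atlas M c -> chart_dom c (p t) ->
    geodesic_vector g a b p c t = 0.
Proof.
move=> crit t0 tab c ac ct; apply/eqP/negPn/negP => vn0.
(* Testing against the value itself makes the pairing positive at [t0], by definiteness of the
   metric. *)
set v := geodesic_vector g a b p c t0 in vn0.
have pos := gcomp_pos g t0 ac ct vn0.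
have nN := geodesic_pairing_near ac tab ct pos.
have [t1 t1ab nN1] := exists_interior_near tab nN.
have t1ab' : t1 \in `[a, b] by exact: subset_itv_oo_cc.
have [ct1 _] := nbhs_singleton nN1 t1ab'.
have [d [e [d0 e0 tube tim]]] := exists_tube v t1ab ct1 nN1.
have tube' t : `|t - t1| < 2 * d -> (t \in `]a, b[) /\ chart_dom c (p t).
  by move=> /tube[].
pose H := bump_variation p c t1 d v.
have Hp : Defs.variation a b p e H := bump_variationP sp ac d0 tube' tim.
have dE t : t \in `[a, b] -> `|t - t1| < 2 * d ->
    first_variation_density g a b H t = bump_fun t1 d t *
      bilin (gcomp g c t (p t)) (geodesic_vector g a b p c t) v.
  move=> tab' td; have [_ cpt _] := tube t td.
  rewrite (first_variation_densityE g ab e0 Hp ac tab' cpt).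
  rewrite (svel_bump_variation_near e0 tim td) !bilinE mulr_sumr.
  by apply: eq_bigr => j _; rewrite mxE mulrA.
have d_ge0 t : t \in `[a, b] -> 0 <= first_variation_density g a b H t.
  move=> tab'; have [td|td] := ltP `|t - t1| (2 * d).
    have [_ _ /(_ tab')[_ Nt]] := tube t td.
    by rewrite (dE t tab' td); apply: mulr_ge0 (bump_fun_ge0 _ _ _) (ltW Nt).
  rewrite (first_variation_density_fixed e0 Hp tab') //.
  exact: (svel_bump_variation_far _ d0 tube' _ td).
have t1d : `|t1 - t1| < 2 * d by rewrite subrr normr0 mulr_gt0.
have d_gt0 : 0 < first_variation_density g a b H t1.
  have [_ _ /(_ t1ab')[_ Nt]] := tube t1 t1d.
  by rewrite (dE t1 t1ab' t1d); apply: mulr_gt0 (bump_fun_gt0 _ d0) Nt.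
have [_ E] := energy_first_variation g ab e0 Hp.
have [_ E0] := crit e H e0 Hp.
(* [E] and [E0] evaluate the same derivative of the energy, so the integral of the density would
   have to be 0. *)
have := continuous_pos_integral_neq0 ab
  (first_variation_density_continuous ab e0 Hp) d_ge0 t1ab d_gt0.
by rewrite -oppr_eq0 -E E0 eqxx.
Qed.

End Criticality.

Theorem proposition4p1 (R : realType) (n : nat) (M : manifold R n)
    (g : riemannian_metric M) (a b : R) (ab : a < b) (gamma : R -> M)
    (gamma_smooth : smooth_map (`[a, b] : set R) gamma) :
  critical g a b gamma <->
  (forall t : R, t \in `[a, b] ->
   forall c, atlas M c -> chart_dom c (gamma t) ->
     covariant_derivative g a b gamma (velocity a b gamma) c t +
     sharp g c t (gamma t)
       (flat_dot g c t (gamma t) (velocity a b gamma c t)) = 0).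
Proof.
split; first exact: critical_geodesic.
exact: geodesic_critical.
Qed.
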